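(* Let $\mathscr{M}=\{m_n\}_{n\in\mathbb{N}_0}$ be a weight sequence, $N\ge1$, and let $u\in\mathscr{D}'_{\mathscr{M}}(\mathbb{T}^N)$. Then $$u=\sum_{\xi\in\mathbb{Z}^N}\widehat{u}(\xi)\,e^{ix\xi},$$ with convergence in $\mathscr{D}'_{\mathscr{M}}(\mathbb{T}^N)$.
   Context: $\mathbb{N}=\{1,2,\dots\}$, $\mathbb{N}_0=\mathbb{N}\cup\{0\}$, $\mathbb{T}^N=\mathbb{R}^N/2\pi\mathbb{Z}^N$, and $|\xi|$ is the Euclidean norm of $\xi\in\mathbb{Z}^N$. A weight sequence is a sequence $\mathscr{M}=\{m_n\}_{n\in\mathbb{N}_0}$ of positive reals with: $m_0=m_1=1$; $m_n^2\le m_{n-1}m_{n+1}$ for all $n\in\mathbb{N}$; and there is $H>1$ with $m_{j+k}\le H^{j+k}m_jm_k$ for all $j,k\in\mathbb{N}_0$. $\mathcal{E}_{\mathscr{M}}(\mathbb{T}^N)$ is the space of $f\in C^\infty(\mathbb{T}^N)$ (complex-valued) for which there are $C,h>0$ with $|D^\alpha f(x)|\le C h^{|\alpha|}m_{|\alpha|}|\alpha|!$ for all $x\in\mathbb{T}^N$, $\alpha\in\mathbb{N}_0^N$, where $D=-i\partial$. For $h>0$, $\mathcal{E}_{\mathscr{M},h}(\mathbb{T}^N)$ is the Banach space of those $f$ with $\|f\|_{\mathscr{M},h}:=\sup_{x,\alpha}\frac{|D^\alpha f(x)|}{h^{|\alpha|}m_{|\alpha|}|\alpha|!}<\infty$.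 $\mathcal{E}_{\mathscr{M}}(\mathbb{T}^N)$ carries the locally convex inductive limit topology of the spaces $\mathcal{E}_{\mathscr{M},h_n}(\mathbb{T}^N)$ for any strictly increasing positive sequence $h_n\to+\infty$ (the topology does not depend on the choice). $\mathscr{D}'_{\mathscr{M}}(\mathbb{T}^N)$ is the topological dual of $\mathcal{E}_{\mathscr{M}}(\mathbb{T}^N)$, and $\widehat u(\xi)=\frac{1}{(2\pi)^N}\langle u,e^{-ix\xi}\rangle$ for $\xi\in\mathbb{Z}^N$. A function $f$ is regarded as the functional $\langle f,\varphi\rangle=\int_{\mathbb{T}^N}f\varphi\,dx$. A sequence $u_n\to u$ in $\mathscr{D}'_{\mathscr{M}}(\mathbb{T}^N)$ if $\langle u_n,\varphi\rangle\to\langle u,\varphi\rangle$ for all $\varphi\in\mathcal{E}_{\mathscr{M}}(\mathbb{T}^N)$; convergence of the series means convergence in this sense of the partial sums over $|\xi|\le j$ as $j\to\infty$. *)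

(* Defs.v *)
From HB Require Import structures.
From mathcomp Require Import all_boot all_order all_algebra.
From mathcomp Require Import all_classical all_reals all_analysis.
From mathcomp Require Import complex.
From mathcomp Require Import ring lra.

Set Implicit Arguments.
Unset Strict Implicit.
Unset Printing Implicit Defensive.

Import Order.TTheory GRing.Theory Num.Theory.
Import numFieldNormedType.Exports.

Local Open Scope classical_set_scope.
Local Open Scope ring_scope.
Local Open Scope complex_scope.

Local Notation reC := (@complex.Re _).
Local Notation imC := (@complex.Im _).

Record weight_seq (R : realType) := WeightSeq {
  wseq :> nat -> R ;
  wseq_gt0 : forall n, 0 < wseq n ;
  wseq0 : wseq 0%N = 1 ;
  wseq1 : wseq 1%N = 1 ;
  wseq_logconvex : forall n, (0 < n)%N ->
    wseq n ^+ 2 <= wseq n.-1 * wseq n.+1 ;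
  wseq_growth : exists2 H : R, 1 < H &
    forall j k, wseq (j + k)%N <= H ^+ (j + k)%N * wseq j * wseq k }.

Section torus_functions.
Variables (R : realType) (N : nat).
Local Notation V := 'rV[R]_N.
Implicit Types (f g : V -> R[i]) (s : seq 'I_N) (a : {ffun 'I_N -> nat}).

(* Functions on the torus R^N / 2 pi Z^N are the (2 pi Z^N)-periodic
   functions on R^N. *)
Definition torus_periodic f :=
  forall (x : V) (k : 'rV[int]_N), f (x + (2 * pi) *: map_mx intr k) = f x.

(* D_j = - i d/dx_j; R[i] carries no normed space structure over R, whence the
   real and imaginary parts. *)
Definition torusD (j : 'I_N) f : V -> R[i] := fun x =>
  - 'i%C * ('D_(delta_mx 0 j) (reC \o f) x +i*
            'D_(delta_mx 0 j) (imC \o f) x)%C.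

(* D_{j_1} ... D_{j_k} f, for s = [:: j_1; ...; j_k] *)
Definition iterD s f : V -> R[i] := foldr torusD f s.

Definition smooth f := forall s,
  [/\ continuous (reC \o iterD s f),
      continuous (imC \o iterD s f),
      forall x j, derivable (reC \o iterD s f) x (delta_mx 0 j) &
      forall x j, derivable (imC \o iterD s f) x (delta_mx 0 j)].

Definition mi_deg a : nat := (\sum_i a i)%N.

Definition mi_seq a : seq 'I_N := flatten [seq nseq (a j) j | j <- enum 'I_N].

Definition mderive a f : V -> R[i] := iterD (mi_seq a) f.

Definition torus_dot (xi : 'rV[int]_N) (x : V) : R :=
  \sum_j (xi 0 j)%:~R * x 0 j.

Definition torus_exp (xi : 'rV[int]_N) : V -> R[i] := fun x =>
  (cos (torus_dot xi x) +i* sin (torus_dot xi x))%C.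

Definition freq_norm (xi : 'rV[int]_N) : R :=
  Num.sqrt (\sum_j (xi 0 j)%:~R ^+ 2).

End torus_functions.

(* integral over [0, 2 pi]^n, as an iterated integral *)
Fixpoint cube_integral (R : realType) (n : nat) : ('rV[R]_n -> R) -> R :=
  match n with
  | 0%N => fun g => g 0
  | n'.+1 => fun g =>
      Rintegral lebesgue_measure `[0, 2 * pi]
        (fun t => cube_integral (fun y : 'rV[R]_n' => g (row_mx t%:M y)))
  end.

Definition torus_integral (R : realType) (N : nat) (f : 'rV[R]_N -> R[i]) :
    R[i] :=
  (cube_integral (reC \o f) +i* cube_integral (imC \o f))%C.

Section torus_lemmas.
Variables (R : realType) (N : nat).
Local Notation V := 'rV[R]_N.
Implicit Types (f g : V -> R[i]) (s : seq 'I_N) (a : {ffun 'I_N -> nat}).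

Lemma size_mi_seq a : size (mi_seq a) = mi_deg a.
Proof.
rewrite /mi_seq size_flatten /shape -map_comp /mi_deg sumnE big_map big_enum /=.
by apply: eq_bigr => j _; rewrite size_nseq.
Qed.

Lemma ReE_lin (c z w : R[i]) : reC (c * z + w) =
  reC c * reC z - imC c * imC z + reC w.
Proof. by case: c z w => [c1 c2] [z1 z2] [w1 w2]. Qed.

Lemma ImE_lin (c z w : R[i]) : imC (c * z + w) =
  reC c * imC z + imC c * reC z + imC w.
Proof. by case: c z w => [c1 c2] [z1 z2] [w1 w2]. Qed.

Lemma derivable_lin3 (k1 k2 : R) (p q r : V -> R) x v :
  derivable p x v -> derivable q x v -> derivable r x v ->
  derivable (k1 *: p + k2 *: q + r) x v.
Proof.
move=> dp dq; apply: derivableD.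
exact: (derivableD (derivableZ (k := k1) dp) (derivableZ (k := k2) dq)).
Qed.

Lemma derive_lin3 (k1 k2 : R) (p q r : V -> R) x v :
  derivable p x v -> derivable q x v -> derivable r x v ->
  'D_v (k1 *: p + k2 *: q + r) x = k1 * 'D_v p x + k2 * 'D_v q x + 'D_v r x.
Proof.
move=> dp dq dr.
have dp1 := derivableZ (k := k1) dp; have dq1 := derivableZ (k := k2) dq.
by rewrite (deriveD (derivableD dp1 dq1) dr) (deriveD dp1 dq1) !deriveZ.
Qed.

Section lin.
Variables (c : R[i]).

Lemma Re_lin_fun f g : reC \o (c *: f + g) =
  reC c *: (reC \o f) + (- imC c) *: (imC \o f) + (reC \o g) :> (V -> R).
Proof. by apply/funext => x; rewrite -[RHS]/(_ * _ + _ * _ + _) mulNr; exact: ReE_lin. Qed.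

Lemma Im_lin_fun f g : imC \o (c *: f + g) =
  reC c *: (imC \o f) + imC c *: (reC \o f)
  + (imC \o g) :> (V -> R).
Proof. by apply/funext => x; exact: ImE_lin. Qed.

Lemma torusD_lin j f g :
  (forall x, derivable (reC \o f) x (delta_mx 0 j)) ->
  (forall x, derivable (imC \o f) x (delta_mx 0 j)) ->
  (forall x, derivable (reC \o g) x (delta_mx 0 j)) ->
  (forall x, derivable (imC \o g) x (delta_mx 0 j)) ->
  torusD j (c *: f + g) = c *: torusD j f + torusD j g.
Proof.
move=> f1 f2 g1 g2; apply/funext => x.
set v : V := delta_mx 0 j.
have eRe : 'D_v (reC \o (c *: f + g)) x =
    reC c * 'D_v (reC \o f) x + (- imC c) * 'D_v (imC \o f) x
    + 'D_v (reC \o g) x.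
  apply: etrans (derive_lin3 _ _ (f1 x) (f2 x) (g1 x)).
  exact: (congr1 (fun h => 'D_v h x) (Re_lin_fun f g)).
have eIm : 'D_v (imC \o (c *: f + g)) x =
    reC c * 'D_v (imC \o f) x + imC c * 'D_v (reC \o f) x
    + 'D_v (imC \o g) x.
  apply: etrans (derive_lin3 _ _ (f2 x) (f1 x) (g2 x)).
  exact: (congr1 (fun h => 'D_v h x) (Im_lin_fun f g)).
have lin (y1 y2 z1 z2 : R) :
    Complex (reC c * y1 + (- imC c) * y2 + z1) (reC c * y2 + imC c * y1 + z2)
    = c * Complex y1 y2 + Complex z1 z2.
  by case: c => c1 c2; rewrite mulNr.
rewrite -[RHS]/(c * torusD j f x + torusD j g x) /torusD -/v.
by rewrite eRe eIm lin mulrDr mulrCA.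
Qed.

Lemma iterD_lin f g s : smooth f -> smooth g ->
  iterD s (c *: f + g) = c *: iterD s f + iterD s g.
Proof.
move=> sf sg; elim: s => [//|j s IH] /=; rewrite IH.
have [_ _ f1 f2] := sf s; have [_ _ g1 g2] := sg s.
by apply: torusD_lin => x.
Qed.

Lemma smooth_lin f g : smooth f -> smooth g -> smooth (c *: f + g).
Proof.
move=> sf sg s; rewrite iterD_lin//.
have [cf1 cf2 f1 f2] := sf s; have [cg1 cg2 g1 g2] := sg s.
split.
- rewrite Re_lin_fun => x; apply: continuousD; last exact: cg1.
  by apply: continuousD; apply: continuousZl_tmp; [exact: cf1|exact: cf2].
- rewrite Im_lin_fun => x; apply: continuousD; last exact: cg2.
  by apply: continuousD; apply: continuousZl_tmp; [exact: cf2|exact: cf1].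
- by move=> x j; rewrite Re_lin_fun; exact: derivable_lin3.
- by move=> x j; rewrite Im_lin_fun; exact: derivable_lin3.
Qed.

End lin.

Lemma torusD0 j : torusD j (0 : V -> R[i]) = 0.
Proof.
apply/funext => x; rewrite /torusD.
have -> : reC \o (0 : V -> R[i]) = cst 0 by [].
have -> : imC \o (0 : V -> R[i]) = cst 0 by [].
by rewrite derive_cst mulr0.
Qed.

Lemma iterD0 s : iterD s (0 : V -> R[i]) = 0.
Proof. by elim: s => [//|j s IH] /=; rewrite IH torusD0. Qed.

Lemma smooth0 : smooth (0 : V -> R[i]).
Proof.
move=> s; rewrite iterD0.
have -> : reC \o (0 : V -> R[i]) = cst 0 by [].
have -> : imC \o (0 : V -> R[i]) = cst 0 by [].
split=> [x|x|x j|x j]; [exact: cst_continuous|exact: cst_continuous| |];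
  exact: derivable_cst.
Qed.

Lemma mderive_lin c f g a : smooth f -> smooth g ->
  mderive a (c *: f + g) = c *: mderive a f + mderive a g.
Proof. exact: iterD_lin. Qed.

Lemma mderive0 a : mderive a (0 : V -> R[i]) = 0.
Proof. exact: iterD0. Qed.

Lemma mderiveZ c f a : smooth f -> mderive a (c *: f) = c *: mderive a f.
Proof.
move=> sf; have := mderive_lin c a sf smooth0.
by rewrite mderive0 !addr0.
Qed.

End torus_lemmas.

Section torus_exp_lemmas.
Variables (R : realType) (N : nat).
Local Notation V := 'rV[R]_N.
Implicit Types (s : seq 'I_N) (xi : 'rV[int]_N).

Lemma torus_dot_line xi (x v : V) (t : R) :
  torus_dot xi (t *: v + x) = t * torus_dot xi v + torus_dot xi x.
Proof.
rewrite /torus_dot mulr_sumr -big_split /=.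
by apply: eq_bigr => j _; rewrite !mxE; ring.
Qed.

Lemma torus_dot_delta xi (j : 'I_N) :
  torus_dot xi (delta_mx 0 j : V) = (xi 0 j)%:~R.
Proof.
rewrite /torus_dot (bigD1 j)//= big1 ?addr0; last first.
  by move=> k kj; rewrite mxE eqxx (negbTE kj) mulr0.
by rewrite mxE !eqxx mulr1.
Qed.

Lemma is_derive_dot (h : R -> R) (dh : R -> R) xi (x v : V) :
  (forall t, is_derive t (1 : R) h (dh t)) ->
  is_derive x v (h \o torus_dot xi) (torus_dot xi v * dh (torus_dot xi x)).
Proof.
move=> dh_; set d := torus_dot xi v; set e := torus_dot xi x.
have dline : is_derive (0 : R) (1 : R) (fun t : R => t * d + e) d.
  have -> : (fun t : R => t * d + e) = (d *: id + cst e :> (R -> R)).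
    by apply/funext => t; rewrite -[RHS]/(d * t + e) mulrC.
  by apply: is_derive_eq; rewrite -[LHS]/(d * 1 + 0) addr0 mulr1.
have dcomp : is_derive (0 : R) (1 : R) (fun t : R => h (t * d + e)) (d * dh e).
  rewrite mulrC; apply: (@is_derive1_comp _ h (fun t : R => t * d + e)) => //.
  by rewrite mul0r add0r.
have hE : (fun t : R => (h \o torus_dot xi) (t *: v + x)) =
    (fun t : R => h (t * d + e)).
  by apply/funext => t; rewrite /= torus_dot_line.
have [dv dvE] := dcomp.
split; first by apply/derivable1P; rewrite hE.
rewrite -dvE -hE /derive.
set g1 := fun t => t^-1 *: _; set g2 := fun t => t^-1 *: _.
suff -> : g1 = g2 by [].
apply/funext => t; rewrite /g1 /g2 /=.
by rewrite addr0 scale0r add0r [_%:A]mulr1.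
Qed.

Lemma continuous_dot xi : continuous (torus_dot xi : V -> R).
Proof.
rewrite /torus_dot; elim: (index_enum _) => [|j r IH] x.
  have -> : (fun y : V => \sum_(j <- [::]) (xi 0 j)%:~R * y 0 j : R) = cst 0.
    by apply/funext => y; rewrite big_nil.
  exact: cst_continuous.
have -> : (fun y : V => \sum_(i <- j :: r) (xi 0 i)%:~R * y 0 i : R) =
    (xi 0 j)%:~R *: (fun y : V => y 0 j) +
    (fun y : V => \sum_(i <- r) (xi 0 i)%:~R * y 0 i : R).
  by apply/funext => y; rewrite big_cons.
apply: continuousD; last exact: IH.
by apply: continuousZl_tmp; exact: coord_continuous.
Qed.

Lemma continuous_torus_exp xi :
  continuous (reC \o torus_exp xi : V -> R) /\
  continuous (imC \o torus_exp xi : V -> R).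
Proof.
split=> x.
  apply: (@continuous_comp _ _ _ (torus_dot xi) (@cos R)).
    exact: continuous_dot.
  exact: continuous_cos.
apply: (@continuous_comp _ _ _ (torus_dot xi) (@sin R)).
  exact: continuous_dot.
exact: continuous_sin.
Qed.

Lemma is_derive_torus_exp xi (x v : V) :
  is_derive x v (reC \o torus_exp xi)
    (torus_dot xi v * - sin (torus_dot xi x)) /\
  is_derive x v (imC \o torus_exp xi)
    (torus_dot xi v * cos (torus_dot xi x)).
Proof.
by split; apply: (is_derive_dot (h := @cos R)) || apply: (is_derive_dot (h := @sin R)).
Qed.

Lemma torusD_exp xi (j : 'I_N) :
  torusD j (torus_exp xi : V -> R[i]) = ((xi 0 j)%:~R : R)%:C *: torus_exp xi.
Proof.
apply/funext => x; rewrite /torusD.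
have [[_ ->] [_ ->]] := is_derive_torus_exp xi x (delta_mx 0 j).
rewrite torus_dot_delta -[RHS]/(((xi 0 j)%:~R : R)%:C * torus_exp xi x).
move: ((xi 0 j)%:~R : R) => k; rewrite /torus_exp.
move: (cos _) (sin _) => a b.
by apply/eqP; rewrite eq_complex /=; apply/andP; split; apply/eqP; ring.
Qed.

Lemma iterD_exp xi s : iterD s (torus_exp xi : V -> R[i]) =
  (\prod_(j <- s) (xi 0 j)%:~R : R)%:C *: torus_exp xi.
Proof.
elim: s => [|j s IH]; first by rewrite big_nil scale1r.
rewrite big_cons /= IH.
have dRe x : derivable (reC \o (torus_exp xi : V -> R[i])) x (delta_mx 0 j).
  by have [[]] := is_derive_torus_exp xi x (delta_mx 0 j).
have dIm x : derivable (imC \o (torus_exp xi : V -> R[i])) x (delta_mx 0 j).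
  by have [_ []] := is_derive_torus_exp xi x (delta_mx 0 j).
have [_ _ s1 s2] := @smooth0 R N [::].
rewrite -[X in torusD j X]addr0.
rewrite (torusD_lin _ dRe dIm (s1 ^~ j) (s2 ^~ j)).
by rewrite torusD0 addr0 torusD_exp scalerA -rmorphM mulrC.
Qed.

Lemma smooth_exp xi : smooth (torus_exp xi : V -> R[i]).
Proof.
move=> s; rewrite iterD_exp -[X in reC \o X]addr0 -[X in imC \o X]addr0.
have [cRe cIm] := continuous_torus_exp xi.
have [c1 c2 s1 s2] := @smooth0 R N [::].
rewrite Re_lin_fun Im_lin_fun; split.
- move=> x; apply: continuousD; last exact: cst_continuous.
  by apply: continuousD; apply: continuousZl_tmp; [exact: cRe|exact: cIm].
- move=> x; apply: continuousD; last exact: cst_continuous.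
  by apply: continuousD; apply: continuousZl_tmp; [exact: cIm|exact: cRe].
- move=> x j; have [[d1 _] [d2 _]] := is_derive_torus_exp xi x (delta_mx 0 j).
  exact: (derivable_lin3 d1 d2 (s1 x j)).
- move=> x j; have [[d1 _] [d2 _]] := is_derive_torus_exp xi x (delta_mx 0 j).
  exact: (derivable_lin3 d2 d1 (s2 x j)).
Qed.

Lemma torus_periodic_exp xi : torus_periodic (torus_exp xi : V -> R[i]).
Proof.
move=> x k; rewrite /torus_exp.
have -> : torus_dot xi (x + (2 * pi) *: map_mx intr k) =
    torus_dot xi x + pi *+ 2 *~ (\sum_j xi 0 j * k 0 j) :> R.
  rewrite addrC torus_dot_line addrC; congr (_ + _).
  rewrite -mulrzr mulr_natl; congr (_ * _); rewrite /torus_dot rmorph_sum /=.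
  by apply: eq_bigr => j _; rewrite mxE rmorphM.
have per (f : R -> R) (T : R) : periodic f T -> forall n y, f (y + T *~ n) = f y.
  move=> fT [n|n] y; first by rewrite -pmulrn (periodicn fT).
  by rewrite NegzE -[RHS](periodicn fT n.+1) mulrNz -pmulrn
    -(periodicn fT n.+1 (y - _)) subrK (periodicn fT).
by rewrite (per _ _ (@cosD2pi R)) (per _ _ (@sinD2pi R)).
Qed.

End torus_exp_lemmas.

Section normc_lemmas.
Variable R : realType.
Implicit Types z w : R[i].

Lemma normc_ge0 z : 0 <= Normc.normc z.
Proof. by case: z => a b; exact: sqrtr_ge0. Qed.

Lemma normcD z w : Normc.normc (z + w) <= Normc.normc z + Normc.normc w.
Proof.
by have := ler_normD z w; case: z w => [a b] [c d]; rewrite !normc_def -rmorphD /= lecR.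
Qed.

Lemma normc_real (k : R) : Normc.normc k%:C = `|k|.
Proof. by rewrite /= expr0n /= addr0 sqrtr_sqr. Qed.

Lemma normc_torus_exp N (xi : 'rV[int]_N) (x : 'rV[R]_N) :
  Normc.normc (torus_exp xi x) = 1.
Proof. by rewrite /= cos2Dsin2 sqrtr1. Qed.

End normc_lemmas.

Section ultradifferentiable.
Variables (R : realType) (N : nat) (M : weight_seq R).
Local Notation V := 'rV[R]_N.
Local Notation mindex := {ffun 'I_N -> nat}.
Implicit Types (f g : V -> R[i]) (h : R).

Definition ultra_weight h (n : nat) : R := h ^+ n * M n * n`!%:R.

Definition ultradiff f := [/\ torus_periodic f, smooth f &
  exists C h, [/\ 0 < C, 0 < h & forall x (a : mindex),
    Normc.normc (mderive a f x) <= C * ultra_weight h (mi_deg a)]].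

Lemma wseq_ge1 n : 1 <= M n.
Proof.
suff [//] : 1 <= M n /\ M n <= M n.+1.
elim: n => [|n [IH1 IH2]]; first by rewrite wseq0 wseq1.
have Mn1 := le_trans IH1 IH2; split=> //.
have := wseq_logconvex M (ltn0Sn n); rewrite /= => H.
have Mp := wseq_gt0 M n.+1.
rewrite -(ler_pM2l Mp) -expr2 (le_trans H)// ler_wpM2r//.
exact/ltW/wseq_gt0.
Qed.

Lemma ultra_weight_gt0 h n : 0 < h -> 0 < ultra_weight h n.
Proof.
by move=> h0; rewrite /ultra_weight !mulr_gt0 ?exprn_gt0 ?wseq_gt0 ?ltr0n ?fact_gt0.
Qed.

Lemma ultra_weight_le h h' n : 0 < h -> h <= h' ->
  ultra_weight h n <= ultra_weight h' n.
Proof.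
move=> h0 hh'; rewrite /ultra_weight ler_wpM2r ?ler0n// ler_wpM2r//.
  exact/ltW/wseq_gt0.
by rewrite lerXn2r ?nnegrE// ltW// (lt_le_trans h0).
Qed.

Lemma ultradiff_lin (c : R[i]) f g :
  ultradiff f -> ultradiff g -> ultradiff (c *: f + g).
Proof.
move=> [pf sf [C [h [C0 h0 fC]]]] [pg sg [C' [h' [C'0 h'0 gC]]]].
split.
- move=> x k; rewrite -[LHS]/(c * f _ + g _) -[RHS]/(c * f x + g x).
  by rewrite pf pg.
- exact: smooth_lin.
exists (Normc.normc c * C + C'), (Num.max h h'); split.
- by rewrite ltr_wpDl// mulr_ge0 ?normc_ge0// ltW.
- by rewrite lt_max h0.
move=> x a; rewrite mderive_lin// -[X in Normc.normc X]/(c * _ x + _ x).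
rewrite (le_trans (normcD _ _))// mulrDl lerD//.
  rewrite Normc.normcM -mulrA ler_wpM2l ?normc_ge0// (le_trans (fC _ _))//.
  apply: ler_wpM2l; first exact: ltW.
  by apply: ultra_weight_le => //; rewrite le_max lexx.
apply: (le_trans (gC _ _)); apply: ler_wpM2l; first exact: ltW.
by apply: ultra_weight_le => //; rewrite le_max lexx orbT.
Qed.

Lemma ultradiff0 : ultradiff 0.
Proof.
split=> //; first exact: smooth0.
exists 1, 1; split=> // x a; rewrite mderive0 Normc.normc0 mul1r.
exact/ltW/ultra_weight_gt0.
Qed.

Lemma ultradiff_exp (xi : 'rV[int]_N) : ultradiff (torus_exp xi).
Proof.
split; [exact: torus_periodic_exp|exact: smooth_exp|].
pose B : R := 1 + \sum_j `|(xi 0 j)%:~R|.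
have B0 : 0 < B by rewrite ltr_pwDl// sumr_ge0.
exists 1, B; split=> // x a.
rewrite /mderive iterD_exp -[X in Normc.normc X]/(_ * torus_exp xi x).
rewrite Normc.normcM normc_torus_exp mulr1 mul1r normc_real.
have /le_trans -> // : `|\prod_(j <- mi_seq a) (xi 0 j)%:~R| <= B ^+ mi_deg a.
  rewrite -size_mi_seq; elim: (mi_seq a) => [|j s IH].
    by rewrite big_nil normr1.
  rewrite big_cons normrM /= exprS ler_pM// /B (bigD1 j)//=.
  by rewrite addrCA lerDl addr_ge0// sumr_ge0.
rewrite /ultra_weight -mulrA; apply: ler_peMr; first exact/exprn_ge0/ltW.
by rewrite mulr_ege1 ?wseq_ge1// ler1n fact_gt0.
Qed.

Definition ultra_pred : {pred V -> R[i]} := fun f => `[< ultradiff f >].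

Lemma ultra_pred_submod : submod_closed ultra_pred.
Proof.
split; first by apply/asboolP; exact: ultradiff0.
by move=> c f g /asboolP uf /asboolP ug; apply/asboolP; exact: ultradiff_lin.
Qed.

HB.instance Definition _ :=
  GRing.isSubmodClosed.Build R[i] (V -> R[i]) ultra_pred ultra_pred_submod.

Record ultra := Ultra { ultra_fun :> V -> R[i] ; _ : ultra_pred ultra_fun }.

HB.instance Definition _ := [isSub for ultra_fun].
HB.instance Definition _ := [Choice of ultra by <:].
HB.instance Definition _ := [SubChoice_isSubLmodule of ultra by <:].

Lemma ultraP (f : ultra) : ultradiff f.
Proof. by case: f => f /= /asboolP. Qed.

Definition ultra_exp (xi : 'rV[int]_N) : ultra :=
  Ultra (introT (asboolP _) (ultradiff_exp xi)).

End ultradifferentiable.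

Arguments ultra {R} N M.

Section inductive_limit.
Variables (R : realType) (N : nat) (M : weight_seq R).
Local Notation mindex := {ffun 'I_N -> nat}.
Local Notation V := 'rV[R]_N.
Local Notation ultra := (ultra N M).
Implicit Types (f g : ultra) (U A : set ultra).

Definition ultra_norm (h : R) (f : ultra) : \bar R :=
  ereal_sup (range (fun p : V * mindex =>
    (Normc.normc (mderive p.2 f p.1) / ultra_weight M h (mi_deg p.2))%:E)).

Definition abs_convex (U : set ultra) := forall (c d : R[i]) f g,
  `|c| + `|d| <= 1 -> U f -> U g -> U (c *: f + d *: g).

(* the trace of U on the normed space {f | ultra_norm h f < +oo} is a
   neighborhood of 0 *)
Definition step_nbhs0 (h : R) (U : set ultra) :=
  exists2 e : R, 0 < e & forall f, (ultra_norm h f < e%:E)%E -> U f.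

Definition indlim_nbhs (h : nat -> R) (f : ultra) : set_system ultra :=
  [set A | exists U, [/\ abs_convex U, forall n, step_nbhs0 (h n) U &
                         forall g, U g -> A (f + g)]].

Lemma ultra_fun0 : (0 : ultra) = (0 : V -> R[i]) :> (V -> R[i]).
Proof. exact: (raddf0 (val : ultra -> (V -> R[i]))). Qed.

Lemma ultra_funZ (c : R[i]) f : c *: f = c *: (f : V -> R[i]) :> (V -> R[i]).
Proof. by []. Qed.

Lemma ultra_norm0 h : ultra_norm h 0 = 0%E.
Proof.
have nx0 (x : V) (a : mindex) :
    Normc.normc (mderive a (0 : ultra) x) / ultra_weight M h (mi_deg a) = 0.
  by rewrite ultra_fun0 mderive0 Normc.normc0 mul0r.
rewrite /ultra_norm [X in ereal_sup X](_ : _ = [set 0%E]) ?ereal_sup1//.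
apply/seteqP; split=> [_ [[x a] _ <-]|_ ->].
  exact: (congr1 EFin (nx0 x a)).
exists (0, [ffun=> 0%N]) => //.
exact: (congr1 EFin (nx0 _ _)).
Qed.

Lemma step_nbhs0_0 h U : step_nbhs0 h U -> U 0.
Proof. by move=> [e e0 eU]; apply: eU; rewrite ultra_norm0 lte_fin. Qed.

Lemma step_nbhs0_double h U : step_nbhs0 h U ->
  step_nbhs0 h [set g | U ((2 : R[i]) *: g)].
Proof.
move=> [e e0 eU]; exists (e / 4); first by rewrite divr_gt0.
move=> f fe; apply: eU.
apply: (@le_lt_trans _ _ (e / 2)%:E); last by rewrite lte_fin; lra.
apply: ge_ereal_sup => _ [[x a] _ <-]; rewrite lee_fin.
have [_ sf _] := ultraP f.
have fxa : Normc.normc (mderive a f x) / ultra_weight M h (mi_deg a) <= e / 4.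
  rewrite -lee_fin (le_trans _ (ltW fe))//.
  by apply: ereal_sup_ubound; exists (x, a).
have n2 : Normc.normc (mderive a ((2 : R[i]) *: f : ultra) x) =
    2 * Normc.normc (mderive a f x).
  rewrite ultra_funZ mderiveZ// -[X in Normc.normc X]/(2 * mderive a f x).
  rewrite Normc.normcM; congr (_ * _).
  by have := normc_real (2 : R); rewrite normr_nat rmorph_nat.
apply: (@le_trans _ _ (2 * (e / 4))); last by lra.
by rewrite -[(x, a).1]/x -[(x, a).2]/a n2 -mulrA ler_pM2l.
Qed.

Lemma indlim_nbhs_filter h f : ProperFilter (indlim_nbhs h f).
Proof.
split.
  by move=> [U [_ /(_ 0%N) /step_nbhs0_0 U0 /(_ 0 U0)]].
split.
- by exists setT; split=> // n; exists 1.
- move=> A B [U [acU sU UA]] [W [acW sW WB]]; exists (U `&` W); split.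
  + move=> c d g g' cd [Ug Wg] [Ug' Wg'].
    by split; [exact: acU|exact: acW].
  + move=> n; have [e e0 eU] := sU n; have [e' e'0 eW] := sW n.
    exists (Num.min e e'); first by rewrite lt_min e0.
    move=> g; rewrite EFin_min lt_min => /andP[ge ge'].
    by split; [exact: eU|exact: eW].
  + by move=> g [Ug Wg]; split; [exact: UA|exact: WB].
- move=> A B AB [U [acU sU UA]]; exists U; split=> // g Ug.
  exact/AB/UA.
Qed.

Lemma indlim_nbhs_singleton h f A : indlim_nbhs h f A -> A f.
Proof.
move=> [U [_ /(_ 0%N) /step_nbhs0_0 U0 UA]].
by rewrite -[f]addr0; exact: UA.
Qed.

Lemma indlim_nbhs_nbhs h f A :
  indlim_nbhs h f A -> indlim_nbhs h f (indlim_nbhs h ^~ A).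
Proof.
move=> [U [acU sU UA]].
have acU2 : abs_convex [set g | U ((2 : R[i]) *: g)].
  move=> c d g g' cd /= Ug Ug'.
  rewrite scalerDr !scalerA ![2 * _]mulrC -!scalerA.
  exact: acU.
have sU2 n : step_nbhs0 (h n) [set g | U ((2 : R[i]) *: g)].
  exact: step_nbhs0_double.
exists [set g | U ((2 : R[i]) *: g)]; split=> // g /= Ug.
exists [set g | U ((2 : R[i]) *: g)]; split=> // g' /= Ug'.
rewrite -addrA; apply: UA.
have half : (2 : R[i])^-1 * 2 = 1 by rewrite mulVf// pnatr_eq0.
have -> : g + g' = 2^-1 *: ((2 : R[i]) *: g) + 2^-1 *: ((2 : R[i]) *: g').
  by rewrite !scalerA half !scale1r.
apply: acU => //.
have half2 : (2 : R[i])^-1 + 2^-1 = 2^-1 * 2 by rewrite mulr_natr mulr2n.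
by rewrite ger0_norm ?invr_ge0 ?ler0n// half2 half.
Qed.

End inductive_limit.

(* ultra N M with the locally convex inductive limit topology of its subspaces
   {f | ultra_norm (h n) f < +oo}: a neighborhood of 0 is a set that contains
   an absolutely convex U whose trace on each of these normed spaces is a
   neighborhood of 0. *)
Definition indlim (R : realType) (N : nat) (M : weight_seq R) (h : nat -> R) :=
  ultra N M.

Section indlim_topology.
Variables (R : realType) (N : nat) (M : weight_seq R) (h : nat -> R).

HB.instance Definition _ := GRing.Lmodule.copy (indlim N M h) (ultra N M).
HB.instance Definition _ :=
  hasNbhs.Build (indlim N M h) (@indlim_nbhs R N M h).
HB.instance Definition _ := Nbhs_isNbhsTopological.Build (indlim N M h)
  (@indlim_nbhs_filter R N M h) (@indlim_nbhs_singleton R N M h)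
  (@indlim_nbhs_nbhs R N M h).

End indlim_topology.

Record ultradistribution (R : realType) (N : nat) (M : weight_seq R)
    (h : nat -> R) := Ultradistribution {
  ultradistribution_fun :> {scalar indlim N M h} ;
  _ : continuous (ultradistribution_fun : indlim N M h -> R[i]^o) }.

Section fourier.
Variables (R : realType) (N : nat) (M : weight_seq R).
Implicit Types (u : ultra N M -> R[i]) (v : nat -> ultra N M -> R[i]).

Definition fourier_coef u (xi : 'rV[int]_N) : R[i] :=
  (((2 * pi) ^+ N)^-1)%:C * u (ultra_exp M (- xi)).

Definition fourier_sum u (j : nat) : 'rV[R]_N -> R[i] := fun x =>
  \sum_(xi \in [set xi : 'rV[int]_N | freq_norm R xi <= j%:R])
    fourier_coef u xi * torus_exp xi x.

Definition fun_distribution (f : 'rV[R]_N -> R[i]) : ultra N M -> R[i] :=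
  fun phi => torus_integral (fun x => f x * phi x).

Definition dual_cvg v u := forall phi : ultra N M,
  (v n phi : R[i]^o) @[n --> \oo] --> (u phi : R[i]^o).

End fourier.

(* Main.v *)
Require Import Defs.
From HB Require Import structures.
From mathcomp Require Import all_boot all_order all_algebra.
From mathcomp Require Import all_classical all_reals all_analysis.
From mathcomp Require Import complex.
From mathcomp Require Import ring lra zify.

Set Implicit Arguments.
Unset Strict Implicit.
Unset Printing Implicit Defensive.

Import Order.TTheory GRing.Theory Num.Theory.
Import numFieldNormedType.Exports.

Local Open Scope classical_set_scope.
Local Open Scope ring_scope.

(** Integrating against [phi] turns the partial sum of the Fourier series of [u]
into [u (T_j phi)], where [T_j phi] is the Fourier partial sum of [phi] over
[|xi| <= j]: everything is a finite sum through which the linear [u] passes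
([fun_distribution_fourier_sum]).  By continuity of [u] it is enough that
[T_j phi] tends to [phi], and one norm [ultra_norm k] suffices: a neighborhood
of 0 in the inductive limit contains a ball of every step, the steps go to
infinity, and the norm decreases in the step.

For that norm, integration by parts shows that [D^a] commutes with [T_j], so the
question is a bound for [T_j f - f] with [f = D^a phi], uniform in the point and
with the right dependence on [a] ([ultradiff_fourier_error]).  The frequency
factors [xi^b] come out of the Fourier coefficients of [f] as further derivatives
of [phi]; with at most [2N+2] of them, the Fourier term at [xi] is at most
[A_a / (prod_i (1 + xi_i^2) * (1 + |xi|^2))].  The growth condition on the
weight sequence separates the orders in the weights [w_h n = h^n * m_n * n!],
namely [w_h (n + p) <= w_(Kh) n * w_(Kh) p] with a constant [K], so that [A_a] is
a constant times [w_(Kh) |a|].  The factor [1 + |xi|^2] exceeds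
[1 + j^2] off the ball and the rest is summable, whence an error
[O(A_a / (1 + j^2))].

This tail estimate presupposes that [f] is the sum of its Fourier series.  The
kernel [|sum_k e^{ik(t-x)}|^2], [k] in the box [[0, n]^N], is nonnegative, and its
normalized integral against [1 - cos (t_j - x_j)] is at most [1/(n+1)].  Since a
continuous periodic [f] satisfies
[|f t - f x| <= e + C * sum_j (1 - cos (t_j - x_j))], the Fejer means of [f]
tend to [f] ([fejer_mean]), with no closed form of the kernel.  A Fejer mean is
also the average over [k] of the sums of the Fourier terms at the frequencies
[k - l]; for [k] away from the boundary of the box these frequencies cover the
ball [|xi| <= j], so that the means differ from [T_j f] by the tail and a
proportion [O(1/n)] of boundary terms ([box_average_ball]).

All functions that have to be integrated are Lipschitz for the l1 distance.  This
property passes to the partial integrals, so that each one-dimensional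
integrand of the iterated integral is continuous. *)

Local Notation reC := (@complex.Re _).
Local Notation imC := (@complex.Im _).
Local Notation iterD := (@Defs.iterD _ _).

(** * Integration of Lipschitz functions over the cube *)

Section cube_integral.
Variable R : realType.
Implicit Types n : nat.

Definition l1dist n (x y : 'rV[R]_n) : R := \sum_j `|x 0 j - y 0 j|.

Definition l1lipschitz n (g : 'rV[R]_n -> R) :=
  exists2 L, 0 <= L & forall x y, `|g x - g y| <= L * l1dist x y.

Lemma l1dist_ge0 n (x y : 'rV[R]_n) : 0 <= l1dist x y.
Proof. exact: sumr_ge0. Qed.

Lemma l1dist_row n (t t' : R) (y y' : 'rV[R]_n) :
  l1dist (row_mx t%:M y) (row_mx t'%:M y') = `|t - t'| + l1dist y y'.
Proof.
rewrite /l1dist big_split_ord big_ord1 !row_mxEl !mxE /=; congr (_ + _).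
by apply: eq_bigr => j _; rewrite !row_mxEr.
Qed.

Lemma l1dist_xx n (x : 'rV[R]_n) : l1dist x x = 0.
Proof. by rewrite /l1dist big1// => j _; rewrite subrr normr0. Qed.

Lemma l1lipschitz_cst n (c : R) : l1lipschitz (fun _ : 'rV[R]_n => c).
Proof. by exists 0 => // x y; rewrite subrr normr0 mul0r. Qed.

Lemma l1lipschitz_lin n (c : R) (g g' : 'rV[R]_n -> R) :
  l1lipschitz g -> l1lipschitz g' -> l1lipschitz (fun x => c * g x + g' x).
Proof.
move=> [L L0 gL] [L' L'0 gL']; exists (`|c| * L + L').
  by rewrite addr_ge0// mulr_ge0.
move=> x y; rewrite opprD addrACA -mulrBr mulrDl (le_trans (ler_normD _ _))//.
by rewrite lerD// normrM -mulrA ler_wpM2l.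
Qed.

Lemma l1lipschitz_row n (g : 'rV[R]_n.+1 -> R) (t : R) :
  l1lipschitz g -> l1lipschitz (fun y : 'rV[R]_n => g (row_mx t%:M y)).
Proof.
move=> [L L0 gL]; exists L => // x y; apply: le_trans (gL _ _) _.
by rewrite l1dist_row subrr normr0 add0r.
Qed.

Lemma cube_integral_cst n (c : R) :
  cube_integral (fun _ : 'rV[R]_n => c) = (2 * pi) ^+ n * c.
Proof.
elim: n => [|n IH] /=; first by rewrite mul1r.
have p0 : 0 <= 2 * pi :> R by rewrite mulr_ge0// pi_ge0.
under eq_Rintegral do rewrite IH.
rewrite Rintegral_cst//= lebesgue_measure_itv/= lte_fin.
case: ifPn => [_|]; first by rewrite -EFinB /= subr0 exprS; ring.
rewrite -leNgt => p1; have /eqP : 2 * pi = 0 :> R by apply/eqP; rewrite eq_le p1 p0.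
by rewrite mulf_eq0 gt_eqF//= gt_eqF ?pi_gt0.
Qed.

Lemma continuous_integrable_segment (G : R -> R) (a b : R) : continuous G ->
  lebesgue_measure.-integrable `[a, b] (EFin \o G).
Proof.
move=> cG; apply: continuous_compact_integrable; first exact: segment_compact.
exact: continuous_subspaceT.
Qed.

Lemma lipschitz_continuous (G : R -> R) (L : R) :
  (forall t t', `|G t - G t'| <= L * `|t - t'|) -> continuous G.
Proof.
move=> GL t; apply/cvgrPdist_lt => e e0.
have L0 : 0 < `|L| + 1 by rewrite ltr_wpDl.
near=> t'; apply: le_lt_trans (GL _ _) _.
apply: (@le_lt_trans _ _ ((`|L| + 1) * `|t - t'|)).
  by rewrite ler_wpM2r// (le_trans (ler_norm _))// lerDl.
rewrite mulrC -ltr_pdivlMr//.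
near: t'; apply: (cvgrPdist_lt _ _).1 => //.
by rewrite divr_gt0.
Unshelve. all: by end_near. Qed.

(** Linearity and monotonicity in dimension [n] bound the increments of a
partial integral over [n] variables by a multiple of the increment of the
remaining variable; the continuity so obtained gives integrability, hence
linearity and monotonicity in dimension [n.+1].  The three statements are
therefore proved by one induction. *)
Lemma cube_integral_lin_le n :
  [/\ forall c (g g' : 'rV[R]_n -> R), l1lipschitz g -> l1lipschitz g' ->
        cube_integral (fun x => c * g x + g' x) =
        c * cube_integral g + cube_integral g',
      forall g g' : 'rV[R]_n -> R, l1lipschitz g -> l1lipschitz g' ->
        (forall x, g x <= g' x) -> cube_integral g <= cube_integral g' &
      forall g : 'rV[R]_n.+1 -> R, l1lipschitz g ->
        continuous (fun t : R => cube_integral (fun y : 'rV[R]_n => g (row_mx t%:M y)))].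
Proof.
have step m :
  (forall c (g g' : 'rV[R]_m -> R), l1lipschitz g -> l1lipschitz g' ->
     cube_integral (fun x => c * g x + g' x) =
     c * cube_integral g + cube_integral g') ->
  (forall g g' : 'rV[R]_m -> R, l1lipschitz g -> l1lipschitz g' ->
     (forall x, g x <= g' x) -> cube_integral g <= cube_integral g') ->
  forall g : 'rV[R]_m.+1 -> R, l1lipschitz g ->
    continuous (fun t : R => cube_integral (fun y : 'rV[R]_m => g (row_mx t%:M y))).
  move=> lin mono g lg; have [L L0 gL] := lg.
  have gl t := l1lipschitz_row t lg.
  suff half t t' : cube_integral (fun y : 'rV[R]_m => g (row_mx t%:M y)) -
      cube_integral (fun y : 'rV[R]_m => g (row_mx t'%:M y))
      <= ((2 * pi) ^+ m * L) * `|t - t'|.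
    apply: (@lipschitz_continuous _ ((2 * pi) ^+ m * L)) => t t'.
    by rewrite ler_norml half andbT lerNl opprB distrC half.
  rewrite lerBlDr -mulrA -cube_integral_cst.
  rewrite -[X in _ <= X + _]mul1r -lin//; last exact: l1lipschitz_cst.
  apply: mono => // [|y].
    by apply: l1lipschitz_lin => //; exact: l1lipschitz_cst.
  rewrite mul1r -lerBlDr (le_trans (ler_norm _))// (le_trans (gL _ _))//.
  by rewrite l1dist_row l1dist_xx addr0.
elim: n => [|n [lin mono cont]].
  have lin0 : forall c (g g' : 'rV[R]_0 -> R), l1lipschitz g -> l1lipschitz g' ->
     cube_integral (fun x => c * g x + g' x) =
     c * cube_integral g + cube_integral g' by [].
  have mono0 : forall g g' : 'rV[R]_0 -> R, l1lipschitz g -> l1lipschitz g' ->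
     (forall x, g x <= g' x) -> cube_integral g <= cube_integral g'.
    by move=> g g' _ _; exact.
  by split=> //; exact: step.
have int g : l1lipschitz g -> lebesgue_measure.-integrable `[0, 2 * pi]
    (EFin \o (fun t : R => cube_integral (fun y : 'rV[R]_n => g (row_mx t%:M y)))).
  by move=> lg; apply: continuous_integrable_segment; exact: cont.
have linS c (g g' : 'rV[R]_n.+1 -> R) : l1lipschitz g -> l1lipschitz g' ->
        cube_integral (fun x => c * g x + g' x) =
        c * cube_integral g + cube_integral g'.
  move=> lg lg' /=; rewrite -RintegralZl//; last exact: int.
  rewrite -RintegralD//; [|apply: continuous_integrable_segment|exact: int].
    by apply: eq_Rintegral => t _; rewrite lin//; exact: l1lipschitz_row.
  by move=> t; apply: continuousM; [exact: cst_continuous|exact: cont].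
have monoS (g g' : 'rV[R]_n.+1 -> R) : l1lipschitz g -> l1lipschitz g' ->
        (forall x, g x <= g' x) -> cube_integral g <= cube_integral g'.
  move=> lg lg' gg' /=; apply: le_Rintegral => //; [exact: int|exact: int|].
  by move=> t _; apply: mono => //; exact: l1lipschitz_row.
by split=> //; exact: step.
Qed.

Lemma cube_integral_lin n c (g g' : 'rV[R]_n -> R) :
  l1lipschitz g -> l1lipschitz g' ->
  cube_integral (fun x => c * g x + g' x) = c * cube_integral g + cube_integral g'.
Proof. by have [+ _ _] := cube_integral_lin_le n; exact. Qed.

Lemma le_cube_integral n (g g' : 'rV[R]_n -> R) :
  l1lipschitz g -> l1lipschitz g' ->
  (forall x, g x <= g' x) -> cube_integral g <= cube_integral g'.
Proof. by have [_ + _] := cube_integral_lin_le n; exact. Qed.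

Lemma cube_integral_continuous n (g : 'rV[R]_n.+1 -> R) : l1lipschitz g ->
  continuous (fun t : R => cube_integral (fun y : 'rV[R]_n => g (row_mx t%:M y))).
Proof. by have [_ _] := cube_integral_lin_le n; exact. Qed.

Lemma ler_norm_cube_integral n (g g' : 'rV[R]_n -> R) :
  l1lipschitz g -> l1lipschitz g' ->
  (forall x, `|g x| <= g' x) -> `|cube_integral g| <= cube_integral g'.
Proof.
move=> lg lg' gg'; rewrite ler_norml; apply/andP; split; last first.
  by apply: le_cube_integral => // x; exact: le_trans (ler_norm _) (gg' x).
rewrite -mulN1r -[X in X <= _]addr0 -[X in _ + X](mulr0 ((2 * pi) ^+ n)).
rewrite -cube_integral_cst -cube_integral_lin//; last exact: l1lipschitz_cst.
apply: le_cube_integral => // [|x].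
  by apply: l1lipschitz_lin => //; exact: l1lipschitz_cst.
by rewrite mulN1r addr0; have := gg' x; rewrite ler_norml => /andP[].
Qed.

End cube_integral.

(** * The integral of a partial derivative of a periodic function *)

(** A directional derivative only sees the restriction to a line; this
transports it along a map that sends lines to lines, without any
differentiability of the map. *)
Lemma is_derive_affine (R : realType) (V W : normedModType R) (g : V -> W)
    (F : W -> R) (x v : V) (w : W) (d : R) :
  (forall s, g (s *: v + x) = s *: w + g x) ->
  is_derive (g x) w F d -> is_derive x v (F \o g) d.
Proof.
move=> gE [dF <-].
have E : (fun s : R => s^-1 *: (((F \o g) \o shift x) (s *: v) - (F \o g) x)) =
         (fun s : R => s^-1 *: ((F \o shift (g x)) (s *: w) - F (g x))).
  by apply/funext => s /=; rewrite gE.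
by split; rewrite /derivable /derive E.
Qed.

Section periodic_derivative.
Variable R : realType.
Implicit Types n : nat.

Lemma row_mx_ord0 n (t : R) (y : 'rV[R]_n) :
  (row_mx t%:M y : 'rV[R]_n.+1) 0 ord0 = t.
Proof.
have := row_mxEl (t%:M : 'M[R]_1) y 0 0; rewrite [RHS]mxE eqxx mulr1n => {2}<-.
by congr (fun_of_matrix _ _ _); exact: val_inj.
Qed.

Lemma row_mx_lift0 n (t : R) (y : 'rV[R]_n) (j : 'I_n) :
  (row_mx t%:M y : 'rV[R]_n.+1) 0 (lift ord0 j) = y 0 j.
Proof.
have := row_mxEr (t%:M : 'M[R]_1) y 0 j => <-.
by congr (fun_of_matrix _ _ _); exact: val_inj.
Qed.

Lemma row_mx_delta0 n (s t : R) (y : 'rV[R]_n) :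
  row_mx (s + t)%:M y = s *: delta_mx 0 ord0 + row_mx t%:M y :> 'rV[R]_n.+1.
Proof.
apply/rowP => k; rewrite [RHS]mxE [in RHS]mxE [in RHS]mxE eqxx.
have [j|] := unliftP ord0 k => ->; first by rewrite !row_mx_lift0 mulr0 add0r.
by rewrite !row_mx_ord0 eqxx mulr1.
Qed.

Lemma row_mx_delta_lift n (s t : R) (y : 'rV[R]_n) (j : 'I_n) :
  row_mx t%:M (s *: delta_mx 0 j + y) =
  s *: delta_mx 0 (lift ord0 j) + row_mx t%:M y :> 'rV[R]_n.+1.
Proof.
apply/rowP => k; rewrite [RHS]mxE [in RHS]mxE [in RHS]mxE eqxx.
have [i|] := unliftP ord0 k => ->; last by rewrite !row_mx_ord0 mulr0 add0r.
by rewrite !row_mx_lift0 2!mxE mxE eqxx; congr (_ * _ + _).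
Qed.

Lemma MVT_line (f df : R -> R) (s : R) :
  (forall t, is_derive t (1 : R) f (df t)) ->
  exists2 c, `|c| <= `|s| & f s - f 0 = df c * s.
Proof.
move=> fdf; have cf : continuous f.
  by move=> t; apply/differentiable_continuous/derivable1_diffP; have [] := fdf t.
have [s0|s0] := leP 0 s.
  have [c] := MVT_segment s0 (fun t _ => fdf t) (continuous_subspaceT cf).
  rewrite in_itv /= => /andP[c0 cs] E; exists c; first by rewrite !ger0_norm.
  by rewrite E subr0.
have [c] := MVT_segment (ltW s0) (fun t _ => fdf t) (continuous_subspaceT cf).
rewrite in_itv /= => /andP[c0 cs] E; exists c.
  by rewrite !ler0_norm ?lerN2// ltW.
by rewrite -opprB E; ring.
Qed.

Lemma is_derive_line n (F dF : 'rV[R]_n -> R) (v : 'rV[R]_n) (x : 'rV[R]_n) (t : R) :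
  (forall x, is_derive x v F (dF x)) ->
  is_derive t (1 : R) (fun t : R => F (t *: v + x)) (dF (t *: v + x)).
Proof.
move=> FdF; apply: (@is_derive_affine _ R^o 'rV[R]_n (fun t : R => t *: v + x)) (FdF _).
by move=> s; rewrite scalerDl -addrA; congr (_ *: _ + _); rewrite [_ *: _]mulr1.
Qed.

(** By the mean value theorem the left-hand side is [s] times a difference of
two values of [dF] at points of the segment. *)
Lemma taylor_delta n (j : 'I_n) (F dF : 'rV[R]_n -> R) (L : R) :
  0 <= L -> (forall x y, `|dF x - dF y| <= L * l1dist x y) ->
  (forall x, is_derive x (delta_mx 0 j) F (dF x)) ->
  forall x s, `|F (s *: delta_mx 0 j + x) - F x - s * dF x| <= L * s ^+ 2.
Proof.
move=> L0 dFL FdF x s.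
have [c cs] := MVT_line s (fun t => is_derive_line x t FdF).
rewrite scale0r add0r => ->.
rewrite mulrC -mulrBr normrM (le_trans (ler_wpM2l _ (dFL _ _)))//.
rewrite -[s ^+ 2]ger0_norm ?sqr_ge0// normrX mulrCA ler_wpM2l//.
rewrite expr2 ler_wpM2l// (le_trans _ cs)//.
rewrite /l1dist (bigD1 j)//= big1 ?addr0 => [|k kj].
  by rewrite !mxE !eqxx mulr1 addrK.
by rewrite !mxE (negbTE kj) andbF mulr0 add0r subrr normr0.
Qed.

Lemma is_derive_quadratic (H : R -> R) (t d K : R) :
  (forall s, `|H (s + t) - H t - s * d| <= K * s ^+ 2) ->
  is_derive t (1 : R) H d.
Proof.
move=> HK.
suff cv : (fun s : R => s^-1 *: ((H \o shift t) (s *: (1 : R)) - H t)) @ 0^' --> d.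
  by split; [apply/cvg_ex; exists d|exact: cvg_lim cv].
apply/cvgrPdist_lt => e e0.
have K0 : 0 < `|K| + 1 by rewrite ltr_wpDl.
near=> s.
have s0 : s != 0 by near: s; exact: nbhs_dnbhs_neq.
rewrite /= [s *: _]mulr1 distrC -[d in X in `|X|](mulKf s0) -[_ *: _]/(_ * _).
rewrite -mulrBr normrM normfV.
rewrite mulrC ltr_pdivrMr ?normr_gt0// (le_lt_trans (HK s))//.
apply: (@le_lt_trans _ _ ((`|K| + 1) * s ^+ 2)).
  by rewrite ler_wpM2r ?sqr_ge0// (le_trans (ler_norm _))// lerDl.
rewrite -[s ^+ 2]ger0_norm ?sqr_ge0// normrX expr2 mulrA ltr_pM2r ?normr_gt0//.
rewrite mulrC -ltr_pdivlMr//; near: s.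
apply: (dnbhs0_lt (V := R^o)); by rewrite divr_gt0.
Unshelve. all: by end_near. Qed.

(** In the first variable, the uniform quadratic bound of [taylor_delta] can be
integrated, so that one may differentiate under the integral sign; the
fundamental theorem of calculus and periodicity conclude.  In the other variables
the inner integral vanishes by induction. *)
Lemma cube_integral_derive n (j : 'I_n) (F dF : 'rV[R]_n -> R) :
  l1lipschitz F -> l1lipschitz dF ->
  (forall x, F ((2 * pi) *: delta_mx 0 j + x) = F x) ->
  (forall x, is_derive x (delta_mx 0 j) F (dF x)) ->
  cube_integral dF = 0.
Proof.
elim: n => [|n IH] in j F dF *; first by case: j.
move=> lF ldF perF FdF /=.
have [i|] := unliftP ord0 j => jE; subst j.
  have cube0 t : cube_integral (fun y : 'rV[R]_n => dF (row_mx t%:M y)) = 0.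
    apply: (IH i (fun y => F (row_mx t%:M y))) => [||y|y].
    - exact: l1lipschitz_row.
    - exact: l1lipschitz_row.
    - by rewrite row_mx_delta_lift.
    - apply: (is_derive_affine (g := fun y => row_mx t%:M y)) (FdF _).
      by move=> s; exact: row_mx_delta_lift.
  under eq_Rintegral do rewrite cube0.
  by rewrite Rintegral_cst//= mul0r.
pose H t := cube_integral (fun y : 'rV[R]_n => F (row_mx t%:M y)).
pose G t := cube_integral (fun y : 'rV[R]_n => dF (row_mx t%:M y)).
have [L L0 dFL] := ldF.
have HG t : is_derive t (1 : R) H (G t).
  apply: (@is_derive_quadratic _ _ _ ((2 * pi) ^+ n * L)) => s.
  rewrite -mulrA -cube_integral_cst.
  have lt u := l1lipschitz_row u lF.
  have -> : H (s + t) - H t - s * G t = cube_integral (fun y : 'rV[R]_n =>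
      - s * dF (row_mx t%:M y) + (-1 * F (row_mx t%:M y) + F (row_mx (s + t)%:M y))).
    rewrite !cube_integral_lin//; [rewrite /H /G; ring|exact: l1lipschitz_row|].
    exact: l1lipschitz_lin.
  apply: ler_norm_cube_integral => [||y].
  - apply: l1lipschitz_lin; [exact: l1lipschitz_row|exact: l1lipschitz_lin].
  - exact: l1lipschitz_cst.
  - apply: le_trans (taylor_delta L0 dFL FdF (row_mx t%:M y) s).
    by rewrite row_mx_delta0 le_eqVlt; apply/orP; left; apply/eqP; congr `|_|; ring.
have cH : continuous H by exact: cube_integral_continuous.
have pi2 : 0 < 2 * pi :> R by rewrite mulr_gt0// pi_gt0.
rewrite /Rintegral (@continuous_FTC2 R G H)//.
- have -> : H (2 * pi) = H 0.
    rewrite /H; congr cube_integral; apply/funext => y.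
    by rewrite -{1}[2 * pi]addr0 row_mx_delta0 perF.
  by rewrite subee.
- by apply: continuous_subspaceT; exact: cube_integral_continuous.
- split; [by move=> t _; have [] := HG t| |].
  + by apply: cvg_at_right_filter; exact: cH.
  + by apply: cvg_at_left_filter; exact: cH.
- by move=> t _; rewrite derive1E; have [] := HG t.
Qed.

End periodic_derivative.

(** * Smooth functions on the torus are bounded and Lipschitz *)

Section complex_parts.
Variable R : realType.
Implicit Types z w : R[i].

Lemma ler_normRe_normc z : `|reC z| <= Normc.normc z.
Proof. by rewrite -lecR; exact: normc_ge_Re. Qed.

Lemma ler_normIm_normc z : `|imC z| <= Normc.normc z.
Proof.
case: z => a b /=; rewrite -[`|b|]ger0_norm// -sqrtr_sqr ler_wsqrtr//.
by rewrite real_normK ?num_real// lerDr sqr_ge0.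
Qed.

Lemma normc_le_ReIm z : Normc.normc z <= `|reC z| + `|imC z|.
Proof.
case: z => a b /=; rewrite -[leRHS]ger0_norm ?addr_ge0// -sqrtr_sqr ler_wsqrtr//.
by rewrite sqrrD !real_normK ?num_real// addrAC lerDl mulrn_wge0// mulr_ge0.
Qed.

End complex_parts.

Section bounded_lipschitz.
Variables (R : realType) (N : nat).
Local Notation V := 'rV[R]_N.
Implicit Types (f g : V -> R[i]).

(** Boundedness makes the class stable under products. *)
Definition bounded_lipschitz f := exists2 L, 0 <= L &
  (forall x, Normc.normc (f x) <= L) /\
  (forall x y, Normc.normc (f x - f y) <= L * l1dist x y).

Lemma bounded_lipschitz_Re f : bounded_lipschitz f -> l1lipschitz (reC \o f).
Proof.
move=> [L L0 [_ fL]]; exists L => // x y; apply: le_trans (fL x y).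
by rewrite /= -raddfB; exact: ler_normRe_normc.
Qed.

Lemma bounded_lipschitz_Im f : bounded_lipschitz f -> l1lipschitz (imC \o f).
Proof.
move=> [L L0 [_ fL]]; exists L => // x y; apply: le_trans (fL x y).
by rewrite /= -raddfB; exact: ler_normIm_normc.
Qed.

Lemma bounded_lipschitz_cst (c : R[i]) : bounded_lipschitz (fun=> c).
Proof.
exists (Normc.normc c); first exact: normc_ge0.
by split=> // x y; rewrite subrr Normc.normc0 mulr_ge0 ?normc_ge0 ?l1dist_ge0.
Qed.

Lemma bounded_lipschitzD f g : bounded_lipschitz f -> bounded_lipschitz g ->
  bounded_lipschitz (fun x => f x + g x).
Proof.
move=> [L L0 [Lf fL]] [L' L'0 [Lg gL]]; exists (L + L'); first exact: addr_ge0.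
split=> [x|x y]; first by rewrite (le_trans (normcD _ _))// lerD.
by rewrite opprD addrACA mulrDl (le_trans (normcD _ _))// lerD.
Qed.

Lemma bounded_lipschitzM f g : bounded_lipschitz f -> bounded_lipschitz g ->
  bounded_lipschitz (fun x => f x * g x).
Proof.
move=> [L L0 [Lf fL]] [L' L'0 [Lg gL]].
have LL' : 0 <= L * L' by rewrite mulr_ge0.
exists (L * L' + L * L'); first by rewrite addr_ge0.
split=> [x|x y].
  rewrite Normc.normcM (le_trans (ler_pM _ _ (Lf x) (Lg x))) ?normc_ge0//.
  by rewrite lerDl.
have -> : f x * g x - f y * g y = (f x - f y) * g x + f y * (g x - g y) by ring.
rewrite (le_trans (normcD _ _))// !Normc.normcM mulrDl lerD//.
  rewrite mulrAC; apply: ler_pM => //; exact: normc_ge0.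
by rewrite -mulrA; apply: ler_pM => //; exact: normc_ge0.
Qed.

Lemma bounded_lipschitz_sum (I : Type) (r : seq I) (P : pred I) (F : I -> V -> R[i]) :
  (forall i, bounded_lipschitz (F i)) ->
  bounded_lipschitz (fun x => \sum_(i <- r | P i) F i x).
Proof.
move=> lF; elim: r => [|i r IH].
  have -> : (fun x => \sum_(i <- [::] | P i) F i x) = (fun=> 0).
    by apply/funext => x; rewrite big_nil.
  exact: bounded_lipschitz_cst.
have -> : (fun x => \sum_(i <- i :: r | P i) F i x) =
    (fun x => (if P i then F i x else 0) + \sum_(i <- r | P i) F i x).
  by apply/funext => x; rewrite big_cons; case: (P i) => //; rewrite add0r.
apply: bounded_lipschitzD => //; case: (P i) => //.
exact: bounded_lipschitz_cst.
Qed.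

Lemma translate_near (x y : V) : exists k : 'rV[int]_N,
  forall i, `|(x + (2 * pi) *: map_mx intr k) 0 i - y 0 i| <= pi.
Proof.
have p0 : 0 < 2 * pi :> R by rewrite mulr_gt0// pi_gt0.
exists (\row_i - Num.floor ((x 0 i - y 0 i + pi) / (2 * pi))) => i.
rewrite !mxE; set s := _ / _; have := floor_itv s.
move=> /andP[]; rewrite intrD => f1 f2.
have sE : x 0 i - y 0 i = 2 * pi * s - pi.
  by rewrite /s mulrC divfK ?gt_eqF//; ring.
rewrite addrAC sE intrN ler_norml; apply/andP; split.
  rewrite addrAC lerBrDr addNr mulrN -mulrBr mulr_ge0//.
    exact: ltW.
  by rewrite subr_ge0.
rewrite addrAC lerBlDr mulrN -mulrBr.
have -> : pi + pi = 2 * pi * 1 :> R by ring.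
by rewrite ler_wpM2l ?(ltW p0)// lerBlDl ltW.
Qed.

(** Every orbit under translations meets the compact cube [[-pi, pi]^N]. *)
Lemma periodic_continuous_bounded (g : V -> R) : continuous g ->
  (forall x k, g (x + (2 * pi) *: map_mx intr k) = g x) ->
  exists2 B, 0 <= B & forall x, `|g x| <= B.
Proof.
move=> cg pg.
have := @rV_compact R N (fun=> `[- pi, pi]%classic) (fun=> @segment_compact R _ _).
set K := [set v | _] => cK.
have /compact_bounded [M [_ gM]] : compact (g @` K).
  by apply: continuous_compact => //; exact: continuous_subspaceT.
exists (`|M| + 1) => [|x]; first by rewrite addr_ge0.
have [k xk] := translate_near x 0; rewrite -(pg x k).
apply: (gM (`|M| + 1)); first by rewrite (le_lt_trans (ler_norm _))// ltrDl.
exists (x + (2 * pi) *: map_mx intr k) => // i.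
have := xk i; rewrite [(0 : V) _ _]mxE subr0 ler_norml => xi.
by rewrite /= in_itv.
Qed.

(** Going from [y] to [x] by changing one coordinate at a time reduces this to
the mean value theorem in one variable; this is why the l1 distance is the
convenient one. *)
Lemma l1lipschitz_partial (g : V -> R) (B : R) :
  0 <= B ->
  (forall j x, derivable g x (delta_mx 0 j)) ->
  (forall j x, `|'D_(delta_mx 0 j) g x| <= B) ->
  forall x y, `|g x - g y| <= B * l1dist x y.
Proof.
move=> B0 dg dB x y.
(* the first [k] coordinates of [x] and the remaining ones of [y] *)
pose z (k : nat) : V := \row_j if (j < k)%N then x 0 j else y 0 j.
have -> : g x - g y = \sum_(0 <= k < N) (g (z k.+1) - g (z k)).
  rewrite telescope_sumr//; congr (g _ - g _); apply/rowP => j; rewrite mxE//.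
  by rewrite ltn_ord.
rewrite big_mkord (le_trans (ler_norm_sum _ _ _))// /l1dist mulr_sumr.
apply: ler_sum => k _.
have zE : z k.+1 = (x 0 k - y 0 k) *: delta_mx 0 k + z k.
  apply/rowP => j; rewrite !mxE eqxx /= ltnS leq_eqVlt.
  have [/val_inj ->|/eqP jk] := eqVneq (j : nat) k.
    by rewrite eqxx ltnn mulr1 subrK.
  have -> : (j == k) = false by apply/eqP => e; apply: jk; rewrite e.
  by rewrite mulr0 add0r.
have ddg u : is_derive u (delta_mx 0 k) g ('D_(delta_mx 0 k) g u).
  exact: derivableP.
have [c _] := MVT_line (x 0 k - y 0 k) (fun t => is_derive_line (z k) t ddg).
by rewrite zE scale0r add0r => ->; rewrite normrM ler_wpM2r.
Qed.

End bounded_lipschitz.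

Section torus_smooth.
Variables (R : realType) (N : nat).
Local Notation V := 'rV[R]_N.
Implicit Types (f g : V -> R[i]).

Definition torus_smooth f := torus_periodic f /\ smooth f.

Lemma derive_periodic (g : V -> R) (p v : V) : (forall x, g (x + p) = g x) ->
  forall x, 'D_v g (x + p) = 'D_v g x.
Proof.
move=> gp x; rewrite /derive.
suff -> : (fun h : R => h^-1 *: ((g \o shift (x + p)) (h *: v) - g (x + p))) =
  (fun h : R => h^-1 *: ((g \o shift x) (h *: v) - g x)) by [].
by apply/funext => h /=; rewrite addrA !gp.
Qed.

Lemma torus_smooth_torusD f j : torus_smooth f -> torus_smooth (torusD j f).
Proof.
move=> [pf sf]; split=> [x k|s].
  by rewrite /torusD !derive_periodic// => y /=; rewrite pf.
have -> : iterD s (torusD j f) = iterD (rcons s j) f.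
  by rewrite /Defs.iterD -cats1 foldr_cat.
exact: sf.
Qed.

Lemma torus_smooth_iterD f s : torus_smooth f -> torus_smooth (iterD s f).
Proof.
move=> sf; elim: s => [//|j s IH].
exact: (@torus_smooth_torusD (iterD s f) j IH).
Qed.

Lemma derive_Re_torusD f j x :
  'D_(delta_mx 0 j) (reC \o f) x = - imC (torusD j f x).
Proof.
by rewrite /torusD; set a := 'D__ _ _; set b := 'D__ _ _; rewrite /=; ring.
Qed.

Lemma derive_Im_torusD f j x :
  'D_(delta_mx 0 j) (imC \o f) x = reC (torusD j f x).
Proof.
by rewrite /torusD; set a := 'D__ _ _; set b := 'D__ _ _; rewrite /=; ring.
Qed.

Lemma torus_smooth_bounded f : torus_smooth f ->
  exists2 B, 0 <= B & forall x, `|reC (f x)| <= B /\ `|imC (f x)| <= B.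
Proof.
move=> [pf sf]; have [cR cI _ _] := sf [::].
have [|B B0 HB] := periodic_continuous_bounded cR.
  by move=> x k /=; rewrite pf.
have [|B' B'0 HB'] := periodic_continuous_bounded cI.
  by move=> x k /=; rewrite pf.
exists (B + B') => [|x]; first exact: addr_ge0.
split.
  by apply: le_trans (HB x) _; rewrite lerDl.
by apply: le_trans (HB' x) _; rewrite lerDr.
Qed.

(** The partial derivatives are again continuous and periodic, hence bounded. *)
Lemma torus_smooth_bounded_lipschitz f : torus_smooth f -> bounded_lipschitz f.
Proof.
move=> sf; have [B B0 HB] := torus_smooth_bounded sf.
have /choice[D HD] : forall j : 'I_N, exists D : R, 0 <= D /\
    forall x, `|reC (torusD j f x)| <= D /\ `|imC (torusD j f x)| <= D.
  move=> j; have [D D0 HD] := torus_smooth_bounded (torus_smooth_torusD j sf).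
  by exists D.
pose E := \sum_j D j.
have E0 : 0 <= E by apply: sumr_ge0 => j _; have [] := HD j.
have DE j : D j <= E.
  rewrite /E (bigD1 j)//= lerDl sumr_ge0// => i _; by have [] := HD i.
have [_ _ dR dI] := sf.2 [::].
have lR := @l1lipschitz_partial R N (reC \o f) E E0 (fun j x => dR x j).
have lI := @l1lipschitz_partial R N (imC \o f) E E0 (fun j x => dI x j).
exists (B + B + (E + E)); first by rewrite !addr_ge0.
split=> [x|x y].
  have [? ?] := HB x; rewrite (le_trans (normc_le_ReIm _))//.
  by rewrite -[leLHS]addr0 lerD ?lerD// addr_ge0.
apply: (@le_trans _ _ ((E + E) * l1dist x y)); last first.
  by rewrite ler_wpM2r ?l1dist_ge0// lerDr addr_ge0.
rewrite (le_trans (normc_le_ReIm _))// mulrDl lerD//.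
  rewrite raddfB; apply: lR => j z; rewrite derive_Re_torusD normrN.
  by have [_ /(_ z)[_ h]] := HD j; exact: le_trans h (DE j).
rewrite raddfB; apply: lI => j z; rewrite derive_Im_torusD.
by have [_ /(_ z)[h _]] := HD j; exact: le_trans h (DE j).
Qed.

Lemma torus_smooth_exp (xi : 'rV[int]_N) : torus_smooth (torus_exp xi : V -> R[i]).
Proof. by split; [exact: torus_periodic_exp|exact: smooth_exp]. Qed.

Lemma bounded_lipschitz_exp (xi : 'rV[int]_N) :
  bounded_lipschitz (torus_exp xi : V -> R[i]).
Proof. exact/torus_smooth_bounded_lipschitz/torus_smooth_exp. Qed.

Lemma is_derive_mul_ReIm f g j x : torus_smooth f -> torus_smooth g ->
  is_derive x (delta_mx 0 j) (fun x => reC (f x * g x))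
    (- imC (torusD j f x * g x + f x * torusD j g x)) /\
  is_derive x (delta_mx 0 j) (fun x => imC (f x * g x))
    (reC (torusD j f x * g x + f x * torusD j g x)).
Proof.
move=> [_ /(_ [::])[_ _ fR fI]] [_ /(_ [::])[_ _ gR gI]].
have fRD : is_derive x (delta_mx 0 j) (reC \o f) (- imC (torusD j f x)).
  by rewrite -derive_Re_torusD; exact: derivableP.
have fID : is_derive x (delta_mx 0 j) (imC \o f) (reC (torusD j f x)).
  by rewrite -derive_Im_torusD; exact: derivableP.
have gRD : is_derive x (delta_mx 0 j) (reC \o g) (- imC (torusD j g x)).
  by rewrite -derive_Re_torusD; exact: derivableP.
have gID : is_derive x (delta_mx 0 j) (imC \o g) (reC (torusD j g x)).
  by rewrite -derive_Im_torusD; exact: derivableP.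
move: (torusD j f x) (torusD j g x) fRD fID gRD gID => F' G' fRD fID gRD gID.
have -> : (fun x => reC (f x * g x)) =
    (reC \o f) * (reC \o g) - (imC \o f) * (imC \o g) :> (V -> R).
  apply/funext => y; rewrite /= -[RHS]/(_ * _ - _ * _) /=.
  by case: (f y) (g y) => [a b] [c d].
have -> : (fun x => imC (f x * g x)) =
    (reC \o f) * (imC \o g) + (imC \o f) * (reC \o g) :> (V -> R).
  apply/funext => y; rewrite /= -[RHS]/(_ * _ + _ * _) /=.
  by case: (f y) (g y) => [a b] [c d].
split.
  have := is_deriveB (is_deriveM fRD gRD) (is_deriveM fID gID).
  move=> h; apply: is_derive_eq; rewrite /= /GRing.scale /=.
  by case: (f x) (g x) F' G' {fRD fID gRD gID h} => [a b] [c d] [a' b'] [c' d'] /=; ring.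
have := is_deriveD (is_deriveM fRD gID) (is_deriveM fID gRD).
move=> h; apply: is_derive_eq; rewrite /= /GRing.scale /=.
by case: (f x) (g x) F' G' {fRD fID gRD gID h} => [a b] [c d] [a' b'] [c' d'] /=; ring.
Qed.

End torus_smooth.

(** * Fourier coefficients and integration by parts *)

Section torus_integral.
Variables (R : realType) (N : nat).
Local Notation V := 'rV[R]_N.
Implicit Types (f g : V -> R[i]) (xi : 'rV[int]_N).

Lemma torus_integral_cst (c : R[i]) :
  torus_integral (fun _ : V => c) = (((2 * pi) ^+ N : R)%:C * c)%C.
Proof.
rewrite /torus_integral.
have -> : reC \o (fun _ : V => c) = (fun=> reC c) by [].
have -> : imC \o (fun _ : V => c) = (fun=> imC c) by [].
rewrite !cube_integral_cst; case: c => a b; apply/eqP; rewrite eq_complex /=.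
by apply/andP; split; apply/eqP; ring.
Qed.

Lemma torus_integral_lin (c : R[i]) f g : bounded_lipschitz f -> bounded_lipschitz g ->
  torus_integral (fun x => c * f x + g x) = c * torus_integral f + torus_integral g.
Proof.
move=> lf lg; rewrite /torus_integral.
have [fR fI] := (bounded_lipschitz_Re lf, bounded_lipschitz_Im lf).
have [gR gI] := (bounded_lipschitz_Re lg, bounded_lipschitz_Im lg).
have -> : reC \o (fun x => c * f x + g x) =
   (fun x => reC c * (reC \o f) x + (- imC c * (imC \o f) x + (reC \o g) x)).
  by apply/funext => x; rewrite /= ReE_lin; ring.
have -> : imC \o (fun x => c * f x + g x) =
   (fun x => reC c * (imC \o f) x + (imC c * (reC \o f) x + (imC \o g) x)).
  by apply/funext => x; rewrite /= ImE_lin; ring.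
rewrite !cube_integral_lin//; try exact: l1lipschitz_lin.
apply/eqP; rewrite eq_complex ReE_lin ImE_lin /=.
by apply/andP; split; apply/eqP; ring.
Qed.

Lemma torus_integralZ (c : R[i]) f : bounded_lipschitz f ->
  torus_integral (fun x => c * f x) = c * torus_integral f.
Proof.
move=> lf; have := torus_integral_lin c lf (@bounded_lipschitz_cst R N 0).
rewrite torus_integral_cst mulr0 addr0 => <-; congr torus_integral.
by apply/funext => x; rewrite addr0.
Qed.

Lemma torus_integral_sum (I : Type) (r : seq I) (c : I -> R[i]) (F : I -> V -> R[i]) :
  (forall i, bounded_lipschitz (F i)) ->
  torus_integral (fun x => \sum_(i <- r) c i * F i x) =
  \sum_(i <- r) c i * torus_integral (F i).
Proof.
move=> lF; elim: r => [|i r IH].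
  under eq_fun do rewrite big_nil.
  by rewrite torus_integral_cst mulr0 big_nil.
under eq_fun do rewrite big_cons.
rewrite torus_integral_lin ?IH ?big_cons//; apply: bounded_lipschitz_sum => j.
by apply: bounded_lipschitzM => //; exact: bounded_lipschitz_cst.
Qed.

Lemma normc_torus_integral f (B : R) : bounded_lipschitz f ->
  (forall x, Normc.normc (f x) <= B) ->
  Normc.normc (torus_integral f) <= 2 * (2 * pi) ^+ N * B.
Proof.
move=> lf fB; apply: le_trans (normc_le_ReIm _) _ => /=.
rewrite -mulrA -cube_integral_cst mulrDl mul1r.
apply: lerD; apply: ler_norm_cube_integral => [||x]; try exact: l1lipschitz_cst.
- exact: bounded_lipschitz_Re.
- exact: le_trans (ler_normRe_normc _) (fB x).
- exact: bounded_lipschitz_Im.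
- exact: le_trans (ler_normIm_normc _) (fB x).
Qed.

Lemma torus_expM xi eta (x : V) :
  torus_exp xi x * torus_exp eta x = torus_exp (xi + eta) x.
Proof.
rewrite /torus_exp.
have -> : torus_dot (xi + eta) x = torus_dot xi x + torus_dot eta x.
  rewrite /torus_dot -big_split /=; apply: eq_bigr => j _.
  by rewrite mxE intrD mulrDl.
rewrite cosD sinD; apply/eqP; rewrite eq_complex /=.
by apply/andP; split; apply/eqP; ring.
Qed.

Lemma torus_exp0 (x : V) : torus_exp 0 x = 1.
Proof.
rewrite /torus_exp /torus_dot big1 ?cos0 ?sin0// => j _.
by rewrite mxE mul0r.
Qed.

Lemma torus_expN xi (x : V) : torus_exp (- xi) x = conjc (torus_exp xi x).
Proof.
rewrite /torus_exp.
have -> : torus_dot (- xi) x = - torus_dot xi x.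
  by rewrite /torus_dot -sumrN; apply: eq_bigr => j _; rewrite mxE intrN mulNr.
by rewrite cosN sinN.
Qed.

(** The integrand is [D_j (f * g)], whose real and imaginary parts are, up to
sign, partial derivatives of the imaginary and real parts of [f * g]. *)
Lemma torus_integral_D_mul f g j : torus_smooth f -> torus_smooth g ->
  torus_integral (fun x => torusD j f x * g x + f x * torusD j g x) = 0.
Proof.
move=> sf sg.
have lf := torus_smooth_bounded_lipschitz sf.
have lg := torus_smooth_bounded_lipschitz sg.
have ldf := torus_smooth_bounded_lipschitz (torus_smooth_torusD j sf).
have ldg := torus_smooth_bounded_lipschitz (torus_smooth_torusD j sg).
have lfg := bounded_lipschitzM lf lg.
have ld := bounded_lipschitzD (bounded_lipschitzM ldf lg) (bounded_lipschitzM lf ldg).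
have per x : f ((2 * pi) *: delta_mx 0 j + x) * g ((2 * pi) *: delta_mx 0 j + x)
    = f x * g x.
  have -> : (2 * pi) *: delta_mx 0 j + x =
      x + (2 * pi) *: map_mx intr (delta_mx 0 j : 'rV[int]_N) :> V.
    rewrite addrC; congr (_ + _ *: _); apply/rowP => k; rewrite !mxE.
    by case: (_ && _).
  by rewrite sf.1 sg.1.
rewrite /torus_integral.
have -> : cube_integral (imC \o (fun x => torusD j f x * g x + f x * torusD j g x)) = 0.
  have l : l1lipschitz (fun x => - imC (torusD j f x * g x + f x * torusD j g x)).
    have [L L0 fL] := bounded_lipschitz_Im ld; exists L => // x y.
    by rewrite -opprD normrN; exact: fL.
  have := @cube_integral_derive _ _ j _ _ (bounded_lipschitz_Re lfg) l _
    (fun x => (is_derive_mul_ReIm j x sf sg).1).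
  move=> h; have := cube_integral_lin (-1) l (l1lipschitz_cst N 0).
  rewrite cube_integral_cst mulr0 addr0 h ?mulr0 => [<-|x].
    by congr cube_integral; apply/funext => x; rewrite /= mulN1r opprK addr0.
  by rewrite /= per.
have -> : cube_integral (reC \o (fun x => torusD j f x * g x + f x * torusD j g x)) = 0.
  apply: (@cube_integral_derive _ _ j (imC \o (fun x => f x * g x))) => [|||x].
  - exact: bounded_lipschitz_Im.
  - exact: bounded_lipschitz_Re.
  - by move=> x; rewrite /= per.
  - exact: (is_derive_mul_ReIm j x sf sg).2.
by [].
Qed.

Lemma torus_integral_D_exp f j xi : torus_smooth f ->
  torus_integral (fun x => torusD j f x * torus_exp xi x) =
  - (xi 0 j)%:~R * torus_integral (fun x => f x * torus_exp xi x).
Proof.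
move=> sf; have := torus_integral_D_mul j sf (torus_smooth_exp R xi).
have lf := torus_smooth_bounded_lipschitz sf.
have ldf := torus_smooth_bounded_lipschitz (torus_smooth_torusD j sf).
have le := bounded_lipschitz_exp R xi.
have -> : (fun x => torusD j f x * torus_exp xi x + f x * torusD j (torus_exp xi) x)
  = (fun x => (xi 0 j)%:~R * (f x * torus_exp xi x) + torusD j f x * torus_exp xi x).
  apply/funext => x; rewrite torusD_exp.
  rewrite -[(_ *: torus_exp xi) x]/(_ * torus_exp xi x) rmorph_int; ring.
rewrite torus_integral_lin; [|exact: bounded_lipschitzM..].
by move/eqP; rewrite addrC addr_eq0 => /eqP ->; rewrite mulNr.
Qed.

Lemma torus_integral_iterD_exp f s xi : torus_smooth f ->
  torus_integral (fun x => iterD s f x * torus_exp xi x) =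
  (\prod_(j <- s) - (xi 0 j)%:~R) * torus_integral (fun x => f x * torus_exp xi x).
Proof.
move=> sf; elim: s => [|j s IH]; first by rewrite big_nil mul1r.
rewrite big_cons -mulrA -IH -torus_integral_D_exp//.
exact: torus_smooth_iterD.
Qed.

(** If [xi_j] is not 0, then [xi_j * torus_exp xi] is the derivative
[D_j (torus_exp xi)], whose integral vanishes. *)
Lemma torus_integral_exp xi :
  torus_integral (torus_exp xi : V -> R[i]) = (xi == 0)%:R * ((2 * pi) ^+ N : R)%:C%C.
Proof.
have [->|/eqP xi0] := eqVneq xi 0.
  have -> : torus_exp 0 = (fun=> 1) :> (V -> R[i]).
    by apply/funext => x; rewrite torus_exp0.
  by rewrite torus_integral_cst mulr1 mul1r.
have [j xij] : exists j, xi 0 j != 0.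
  apply/not_existsP => h; apply: xi0; apply/rowP => j.
  by have := h j; rewrite mxE => /negP; rewrite negbK => /eqP.
have := torus_integral_D_exp j 0 (torus_smooth_exp R xi).
rewrite mxE oppr0 mul0r mul0r => h; apply/eqP.
have : (xi 0 j)%:~R * torus_integral (torus_exp xi) = 0 :> R[i].
  rewrite -h -torus_integralZ; last exact: bounded_lipschitz_exp.
  congr torus_integral; apply/funext => x; rewrite torus_exp0 mulr1 torusD_exp.
  by rewrite -[(_ *: torus_exp xi) x]/(_ * torus_exp xi x) rmorph_int.
by move/eqP; rewrite mulf_eq0 intr_eq0 (negbTE xij).
Qed.

End torus_integral.

(** * The Fejer kernel *)

Section korovkin.
Variables (R : realType) (N : nat).
Local Notation V := 'rV[R]_N.
Implicit Types (f g : V -> R[i]) (xi : 'rV[int]_N) (x t : V).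

(** The real part of a product of exponentials, because such products can be
integrated against the Fejer kernel; it is [1 - cos (t_j - x_j)], see
[cos_gapE]. *)
Definition cos_gap x t (j : 'I_N) : R :=
  1 - reC (torus_exp (delta_mx 0 j) t * torus_exp (- delta_mx 0 j) x).

Lemma cos_gapE x t j : cos_gap x t j = 1 - cos (t 0 j - x 0 j).
Proof.
have dE (y : V) : torus_dot (delta_mx 0 j) y = y 0 j.
  rewrite /torus_dot (bigD1 j)//= big1 ?addr0 => [|k kj].
    by rewrite mxE !eqxx mul1r.
  by rewrite mxE (negbTE kj) andbF mul0r.
by rewrite /cos_gap torus_expN /torus_exp !dE /= cosB mulrN opprK.
Qed.

Lemma cos_gap_ge0 x t j : 0 <= cos_gap x t j.
Proof. by rewrite cos_gapE subr_ge0 cos_le1. Qed.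

(** Translate [t] by a period into the cube of radius [pi] around [x].  If all
coordinates are within [d] of those of [x], the Lipschitz bound gives [e];
otherwise one of the gaps is at least [1 - cos d], and the boundedness of [f]
gives the rest. *)
Lemma korovkin_bound f : torus_periodic f -> bounded_lipschitz f ->
  forall x (e : R), 0 < e -> exists2 C, 0 <= C & forall t,
  Normc.normc (f t - f x) <= e + C * \sum_j cos_gap x t j.
Proof.
move=> pf [L L0 [fL lf]] x e e0.
pose d := Num.min pi (e / (L * N%:R + 1)).
have LN : 0 < L * N%:R + 1 by rewrite ltr_wpDl// mulr_ge0.
have d0 : 0 < d by rewrite lt_min pi_gt0 divr_gt0.
have dpi : d <= pi by rewrite ge_min lexx.
have cd : 0 < 1 - cos d.
  by rewrite subr_gt0 -[X in _ < X]cos0 ltr_cos// in_itv/= ?lexx ?pi_ge0 ?(ltW d0).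
exists (2 * L / (1 - cos d)) => [|t0]; first by rewrite divr_ge0 ?mulr_ge0// ltW.
have [k] := translate_near t0 x; set t := t0 + _ => tx.
have -> : f t0 = f t by rewrite /t pf.
have -> : \sum_j cos_gap x t0 j = \sum_j cos_gap x t j.
  by apply: eq_bigr => j _; rewrite /cos_gap /t torus_periodic_exp.
have S0 : 0 <= \sum_j cos_gap x t j by apply: sumr_ge0 => j _; exact: cos_gap_ge0.
have C0 : 0 <= 2 * L / (1 - cos d) by rewrite divr_ge0 ?mulr_ge0// ltW.
have [[j dj]|far] := pselect (exists j, d < `|t 0 j - x 0 j|).
  apply: (@le_trans _ _ (2 * L)).
    by rewrite mulr_natl mulr2n (le_trans (normcD _ _))// normcN lerD.
  rewrite (@le_trans _ _ (2 * L / (1 - cos d) * \sum_j cos_gap x t j)) ?lerDr ?(ltW e0)//.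
  rewrite -mulrA ler_peMr ?mulr_ge0// mulrC ler_pdivlMr// mul1r.
  rewrite (bigD1 j)//= (@le_trans _ _ (cos_gap x t j))//; last first.
    by rewrite lerDl sumr_ge0// => i _; exact: cos_gap_ge0.
  rewrite cos_gapE lerD2l lerN2.
  have -> : cos (t 0 j - x 0 j) = cos `|t 0 j - x 0 j|.
    by case: ler0P => _ //; rewrite cosN.
  by apply/ltW; rewrite ltr_cos// in_itv/= ?normr_ge0 ?tx// (ltW d0).
apply: (@le_trans _ _ e); last by rewrite lerDl mulr_ge0.
apply: le_trans (lf _ _) _; apply: (@le_trans _ _ (L * \sum_(j < N) d)).
  rewrite ler_wpM2l// ler_sum// => j _; rewrite leNgt; apply/negP => dj.
  by apply: far; exists j.
rewrite sumr_const card_ord -[d *+ N]mulr_natl mulrA.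
apply: (@le_trans _ _ ((L * N%:R + 1) * d)).
  by rewrite ler_wpM2r ?(ltW d0)// lerDl.
by rewrite mulrC -ler_pdivlMr// ge_min lexx orbT.
Qed.

End korovkin.

Section fejer.
Variables (R : realType) (N : nat).
Local Notation V := 'rV[R]_N.
Implicit Types (f g : V -> R[i]) (xi : 'rV[int]_N) (x t : V) (n : nat).

Definition box_freq n (k : {ffun 'I_N -> 'I_n.+1}) : 'rV[int]_N :=
  \row_j (k j : nat)%:Z.

Arguments box_freq : clear implicits.

(** Fixing one coordinate of the box leaves [(n+1)^(N-1)] points; both sides are
multiplied by [n+1] to avoid the predecessor. *)
Lemma sum_box_coord n (j : 'I_N) (P : pred 'I_n.+1) :
  n.+1%:R * \sum_(k : {ffun 'I_N -> 'I_n.+1}) (P (k j))%:R =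
  #|P|%:R * n.+1%:R ^+ N :> R.
Proof.
pose F i (m : 'I_n.+1) : R := if i == j then (P m)%:R else 1.
transitivity (n.+1%:R * \prod_i \sum_m F i m).
  rewrite bigA_distr_bigA /=; congr (_ * _); apply: eq_bigr => k _.
  rewrite (bigD1 j)//= big1 /F ?eqxx ?mulr1// => i /negbTE ->//.
have -> : \prod_i \sum_m F i m = #|P|%:R * n.+1%:R ^+ N.-1.
  rewrite (bigD1 j)//=; congr (_ * _).
    have -> : #|P| = (\sum_m P m)%N.
      rewrite -sum1_card big_mkcond; apply: eq_bigr => m _.
      by rewrite unfold_in; case: (P m).
    by rewrite /F eqxx natr_sum.
  rewrite (eq_bigr (fun=> n.+1%:R)) => [|i /negbTE ij].
    by rewrite prodr_const cardC1 card_ord.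
  by rewrite /F ij sumr_const card_ord.
by rewrite mulrCA -exprS prednK// (leq_ltn_trans _ (ltn_ord j)).
Qed.

(** The kernel is not normalized: it is [(n+1)^N] times the usual product of
one-dimensional Fejer kernels, centered at [x]. *)
Definition fejer n x t : R[i] :=
  \sum_k \sum_l torus_exp (box_freq n k - box_freq n l) t *
                torus_exp (- (box_freq n k - box_freq n l)) x.

(** The kernel is the squared modulus of [sum_k torus_exp k (t - x)]. *)
Lemma fejerE n x t : exists2 w : R, 0 <= w & fejer n x t = w%:C%C.
Proof.
pose E k := torus_exp (box_freq n k) t * torus_exp (- box_freq n k) x.
pose S := \sum_k E k.
exists ((reC S) ^+ 2 + (imC S) ^+ 2); first by rewrite addr_ge0// sqr_ge0.
have -> : fejer n x t = S * conjc S.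
  have -> : conjc S = \sum_k torus_exp (- box_freq n k) t * torus_exp (box_freq n k) x.
    rewrite /S (rmorph_sum (@conjc R)); apply: eq_bigr => k _.
    by rewrite /E (rmorphM (@conjc R)) [torus_exp (- _) t]torus_expN; congr (_ * _);
       rewrite -[LHS]/(conjc _) -torus_expN opprK.
  rewrite /S big_distrlr /=; apply: eq_bigr => k _; apply: eq_bigr => l _.
  by rewrite opprB -!torus_expM /E; ring.
case: S => a b; apply/eqP; rewrite eq_complex /=; apply/andP; split; apply/eqP; ring.
Qed.

(** The term of the Fourier series of [f] at [x] with frequency [- xi]; this
sign is the one that appears when [f] is paired with [torus_exp xi]. *)
Definition fourier_term f x xi : R[i] :=
  (((2 * pi) ^+ N : R)^-1)%:C%C *
  torus_integral (fun t => f t * torus_exp xi t) * torus_exp (- xi) x.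

Lemma bounded_lipschitz_fejer n x : bounded_lipschitz (fejer n x).
Proof.
apply: bounded_lipschitz_sum => k; apply: bounded_lipschitz_sum => l.
apply: bounded_lipschitzM; [exact: bounded_lipschitz_exp|exact: bounded_lipschitz_cst].
Qed.

Lemma twopiX_neq0 : ((2 * pi) ^+ N : R) != 0.
Proof. by rewrite expf_neq0// mulf_neq0// gt_eqF ?pi_gt0. Qed.

Lemma torus_integral_fejer f n x : bounded_lipschitz f ->
  torus_integral (fun t => f t * fejer n x t) =
  ((2 * pi) ^+ N : R)%:C%C *
  \sum_k \sum_l fourier_term f x (box_freq n k - box_freq n l).
Proof.
move=> lf.
have lfe xi : bounded_lipschitz (fun t => f t * torus_exp xi t).
  by apply: bounded_lipschitzM => //; exact: bounded_lipschitz_exp.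
have -> : (fun t => f t * fejer n x t) = (fun t => \sum_k 1 * (\sum_l
    torus_exp (- (box_freq n k - box_freq n l)) x *
    (f t * torus_exp (box_freq n k - box_freq n l) t))).
  apply/funext => t; rewrite /fejer mulr_sumr; apply: eq_bigr => k _.
  by rewrite mul1r mulr_sumr; apply: eq_bigr => l _; ring.
rewrite torus_integral_sum => [|k]; last first.
  apply: bounded_lipschitz_sum => l; apply: bounded_lipschitzM => //.
  exact: bounded_lipschitz_cst.
rewrite mulr_sumr; apply: eq_bigr => k _.
rewrite mul1r torus_integral_sum// mulr_sumr; apply: eq_bigr => l _.
rewrite /fourier_term !mulrA -rmorphM divff ?twopiX_neq0// rmorph1 mul1r.
by rewrite mulrC.
Qed.

Lemma fourier_term_exp eta x xi :
  fourier_term (fun t => torus_exp eta t * torus_exp (- eta) x) x xi =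
  (eta + xi == 0)%:R.
Proof.
rewrite /fourier_term.
have -> : (fun t => torus_exp eta t * torus_exp (- eta) x * torus_exp xi t) =
    (fun t => torus_exp (- eta) x * torus_exp (eta + xi) t).
  by apply/funext => t; rewrite -torus_expM; ring.
rewrite torus_integralZ ?torus_integral_exp; last exact: bounded_lipschitz_exp.
case: eqP => [h|_]; last by rewrite !(mul0r, mulr0).
rewrite mul1r mulrCA -rmorphM mulVf ?twopiX_neq0// rmorph1 mulr1.
by rewrite torus_expM -opprD h oppr0 torus_exp0.
Qed.

Lemma box_freq_inj n : injective (box_freq n).
Proof.
move=> k l /rowP kl; apply/ffunP => j; apply: val_inj.
by have := kl j; rewrite !mxE => -[].
Qed.

Lemma sum_box_diag n :
  (\sum_k \sum_l (box_freq n k - box_freq n l == 0)%R = n.+1 ^ N)%N.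
Proof.
rewrite (eq_bigr (fun=> 1%N)) => [|k _].
  by rewrite sum1_card card_ffun !card_ord.
rewrite (bigD1 k)//= subrr eqxx big1 ?addn0// => l /negbTE lk.
by rewrite subr_eq0 (inj_eq (@box_freq_inj n)) eq_sym lk.
Qed.

(** Every [k] has a unique partner [l], the shift of [k] by one in direction [j],
except when this shift leaves the box. *)
Lemma sum_box_shift n (j : 'I_N) :
  (n.+1 ^ N <= \sum_k \sum_l (delta_mx 0 j + (box_freq n k - box_freq n l) == 0)%R +
    \sum_(k : {ffun 'I_N -> 'I_n.+1}) (k j == ord_max))%N.
Proof.
have -> : (n.+1 ^ N = \sum_(k : {ffun 'I_N -> 'I_n.+1}) 1)%N.
  by rewrite sum1_card card_ffun !card_ord.
rewrite -big_split /=; apply: leq_sum => k _.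
have [_|kj] := eqVneq (k j) ord_max; first by rewrite addn1.
have kjn : (k j < n)%N.
  by rewrite ltn_neqAle -ltnS ltn_ord andbT -(inj_eq val_inj)/= in kj *.
pose l := [ffun i => if i == j then inord (k j).+1 else k i].
rewrite (bigD1 l)//= -addnA.
have -> : delta_mx 0 j + (box_freq n k - box_freq n l) == 0.
  apply/eqP/rowP => i; rewrite !mxE !ffunE eqxx /=.
  have [->|ij] := eqVneq i j; last by rewrite add0r subrr.
  by rewrite inordK ?ltnS// -[(k j).+1]addn1 PoszD opprD addNKr subrr.
by [].
Qed.

Lemma fourier_term1 x xi : fourier_term (fun=> 1) x xi = (xi == 0)%:R.
Proof.
rewrite -[xi in RHS]add0r -(fourier_term_exp _ x); congr (fourier_term _ _ _).
by apply/funext => t; rewrite oppr0 !torus_exp0 mul1r.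
Qed.

Lemma torus_integral_fejer1 n x :
  torus_integral (fun t => fejer n x t) = ((2 * pi) ^+ N * n.+1%:R ^+ N : R)%:C%C.
Proof.
have := torus_integral_fejer n x (@bounded_lipschitz_cst R N 1).
have -> : (fun t => 1 * fejer n x t) = (fun t => fejer n x t).
  by apply/funext => t; rewrite mul1r.
move=> ->; rewrite rmorphM -natrX -sum_box_diag natr_sum rmorph_sum; congr (_ * _).
apply: eq_bigr => k _; rewrite natr_sum rmorph_sum; apply: eq_bigr => l _.
by rewrite fourier_term1 rmorph_nat.
Qed.

Lemma torus_integral_fejer_exp n x j : exists2 D : R,
  n.+1%:R ^+ N - n.+1%:R ^+ N / n.+1%:R <= D &
  torus_integral (fun t => torus_exp (delta_mx 0 j) t * torus_exp (- delta_mx 0 j) x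
     * fejer n x t) = ((2 * pi) ^+ N * D : R)%:C%C.
Proof.
exists (\sum_k \sum_l (delta_mx 0 j + (box_freq n k - box_freq n l) == 0)%R)%N%:R.
  have := sum_box_shift n j; rewrite -(ler_nat R) natrD natrX -lerBlDr.
  apply: le_trans; rewrite lerD2l lerN2 natr_sum.
  have := sum_box_coord j (pred1 (ord_max : 'I_n.+1)); rewrite card1 mul1r => <-.
  by rewrite mulrC mulKf.
rewrite torus_integral_fejer; last first.
  apply: bounded_lipschitzM; [exact: bounded_lipschitz_exp|exact: bounded_lipschitz_cst].
rewrite rmorphM natr_sum rmorph_sum; congr (_ * _).
apply: eq_bigr => k _; rewrite natr_sum rmorph_sum; apply: eq_bigr => l _.
by rewrite fourier_term_exp rmorph_nat.
Qed.

(** Against the kernel, the constant 1 integrates to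
[(2 * pi) ^+ N * n.+1 ^+ N] and each exponential of [cos_gap] to nearly as much
([torus_integral_fejer_exp]), so that the gaps contribute only a fraction
[1/(n+1)]. *)
Lemma cube_integral_korovkin n x (a C : R) : 0 <= C ->
  cube_integral (fun t => (a + C * \sum_j cos_gap x t j) * reC (fejer n x t)) <=
  (2 * pi) ^+ N * n.+1%:R ^+ N * (a + C * N%:R / n.+1%:R).
Proof.
move=> C0; set p := (2 * pi) ^+ N; set w := n.+1%:R ^+ N.
have p0 : 0 <= p by rewrite exprn_ge0// mulr_ge0// pi_ge0.
pose e j t := torus_exp (delta_mx 0 j) t * torus_exp (- delta_mx 0 j) x.
have le j : bounded_lipschitz (e j).
  apply: bounded_lipschitzM; [exact: bounded_lipschitz_exp|exact: bounded_lipschitz_cst].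
have lK := bounded_lipschitz_fejer n x.
have leK j : bounded_lipschitz (fun t => e j t * fejer n x t).
  exact: bounded_lipschitzM.
have /choice[D HD] : forall j, exists D : R, w - w / n.+1%:R <= D /\
    torus_integral (fun t => e j t * fejer n x t) = (p * D)%:C%C.
  by move=> j; have [D ? ?] := torus_integral_fejer_exp n x j; exists D.
have -> : cube_integral (fun t => (a + C * \sum_j cos_gap x t j) * reC (fejer n x t))
  = reC (torus_integral (fun t => (a + C * N%:R)%:C%C * fejer n x t +
      \sum_j (- C)%:C%C * (e j t * fejer n x t))).
  rewrite /torus_integral /=; congr cube_integral; apply/funext => t /=.
  have [v _ ->] := fejerE n x t.
  have -> : \sum_j cos_gap x t j = N%:R - \sum_j reC (e j t).
    by rewrite /cos_gap sumrB sumr_const card_ord.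
  have -> : \sum_j (- C)%:C%C * (e j t * v%:C%C) = (- C * v)%:C%C * \sum_j e j t.
    by rewrite mulr_sumr rmorphM; apply: eq_bigr => j _; ring.
  rewrite -raddf_sum; case: (\sum_j e j t) => y z /=; ring.
rewrite torus_integral_lin//; last first.
  apply: bounded_lipschitz_sum => j; apply: bounded_lipschitzM => //.
  exact: bounded_lipschitz_cst.
rewrite torus_integral_sum// torus_integral_fejer1 -/p -/w.
rewrite (eq_bigr (fun j => (- C * (p * D j))%:C%C)) => [|j _]; last first.
  by rewrite (HD j).2 -rmorphM.
rewrite -rmorphM -rmorph_sum -rmorphD /= -mulr_sumr -mulr_sumr.
have DS : N%:R * (w - w / n.+1%:R) <= \sum_j D j.
  have -> : N%:R * (w - w / n.+1%:R) = \sum_(j < N) (w - w / n.+1%:R).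
    by rewrite sumr_const card_ord mulr_natl.
  by apply: ler_sum => j _; exact: (HD j).1.
rewrite -subr_ge0.
have -> : p * w * (a + C * N%:R / n.+1%:R) -
  ((a + C * N%:R) * (p * w) + - C * (p * \sum_j D j)) =
  C * p * (\sum_j D j - N%:R * (w - w / n.+1%:R)) by ring.
by rewrite mulr_ge0 ?mulr_ge0// subr_ge0.
Qed.

Lemma l1lipschitz_korovkin n x (a C : R) :
  l1lipschitz (fun t => (a + C * \sum_j cos_gap x t j) * reC (fejer n x t)).
Proof.
pose e j t : R[i] :=
  1 + -1 * (torus_exp (delta_mx 0 j) t * torus_exp (- delta_mx 0 j) x).
pose g t : R[i] := a%:C%C + \sum_j C%:C%C * e j t.
have le j : bounded_lipschitz (e j).
  apply: bounded_lipschitzD; first exact: bounded_lipschitz_cst.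
  apply: bounded_lipschitzM; first exact: bounded_lipschitz_cst.
  apply: bounded_lipschitzM; first exact: bounded_lipschitz_exp.
  exact: bounded_lipschitz_cst.
have lg : bounded_lipschitz g.
  apply: bounded_lipschitzD; first exact: bounded_lipschitz_cst.
  apply: bounded_lipschitz_sum => j; apply: bounded_lipschitzM => //.
  exact: bounded_lipschitz_cst.
set G := (G in l1lipschitz G).
suff -> : G = reC \o (fun t => g t * fejer n x t).
  apply/bounded_lipschitz_Re/bounded_lipschitzM => //.
  exact: bounded_lipschitz_fejer.
apply/funext => t; rewrite /G /=; have [v _ ->] := fejerE n x t.
have -> : \sum_j cos_gap x t j = reC (\sum_j e j t).
  rewrite raddf_sum; apply: eq_bigr => j _; rewrite /cos_gap /e mulN1r.
  by case: (torus_exp _ t * _).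
rewrite /g -mulr_sumr; case: (\sum_j _) => y z /=; ring.
Qed.

(** Korovkin's argument: the kernel is nonnegative, so integrating it against
[f - f x] is controlled by integrating it against the majorant of
[korovkin_bound]. *)
Lemma fejer_mean f : torus_periodic f -> bounded_lipschitz f ->
  forall x (e : R), 0 < e -> exists2 C, 0 <= C & forall n,
  Normc.normc (((n.+1%:R ^+ N)^-1 : R)%:C%C *
    \sum_k \sum_l fourier_term f x (box_freq n k - box_freq n l) - f x)
  <= e + C / n.+1%:R.
Proof.
move=> pf lf x e e0.
have e20 : 0 < e / 2 by rewrite divr_gt0.
have [C C0 fC] := korovkin_bound pf lf x e20.
exists (2 * (C * N%:R)) => [|n]; first by rewrite !mulr_ge0.
set p := ((2 * pi) ^+ N : R); set w := (n.+1%:R ^+ N : R).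
have p0 : 0 < p by rewrite exprn_gt0// mulr_gt0// pi_gt0.
have w0 : 0 < w by rewrite exprn_gt0.
have lK := bounded_lipschitz_fejer n x.
have lfx : bounded_lipschitz (fun t => f t - f x).
  by apply: bounded_lipschitzD => //; exact: bounded_lipschitz_cst.
have lfK := bounded_lipschitzM lfx lK.
have TE : torus_integral (fun t => (f t - f x) * fejer n x t) =
  (p * w)%:C%C * ((w^-1)%:C%C *
    \sum_k \sum_l fourier_term f x (box_freq n k - box_freq n l) - f x).
  have -> : (fun t => (f t - f x) * fejer n x t) =
      (fun t => - f x * fejer n x t + f t * fejer n x t).
    by apply/funext => t; ring.
  rewrite torus_integral_lin//; last exact: bounded_lipschitzM.
  rewrite torus_integral_fejer1 torus_integral_fejer// -/p -/w.
  rewrite mulrBr mulrA -rmorphM mulfK ?gt_eqF//; ring.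
have ge0 t : 0 <= e / 2 + C * \sum_j cos_gap x t j.
  rewrite addr_ge0 ?(ltW e20)// mulr_ge0// sumr_ge0// => j _; exact: cos_gap_ge0.
pose G t := (e / 2 + C * \sum_j cos_gap x t j) * reC (fejer n x t).
have lG : l1lipschitz G by exact: l1lipschitz_korovkin.
have bnd t : Normc.normc ((f t - f x) * fejer n x t) <= G t.
  rewrite Normc.normcM /G; have [v v0 ->] := fejerE n x t.
  by rewrite normc_real ger0_norm// ler_wpM2r.
have QG := cube_integral_korovkin n x (e / 2) C0; rewrite -/p -/w in QG.
have : Normc.normc (torus_integral (fun t => (f t - f x) * fejer n x t)) <=
   2 * (p * w * (e / 2 + C * N%:R / n.+1%:R)).
  apply: le_trans (normc_le_ReIm _) _; rewrite mulrDl mul1r /=.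
  apply: lerD; (apply: le_trans QG; apply: ler_norm_cube_integral => [||t]) => //.
  - exact: bounded_lipschitz_Re.
  - exact: le_trans (ler_normRe_normc _) (bnd t).
  - exact: bounded_lipschitz_Im.
  - exact: le_trans (ler_normIm_normc _) (bnd t).
rewrite TE Normc.normcM normc_real ger0_norm; last by rewrite mulr_ge0 ?ltW.
rewrite mulrCA ler_pM2l ?mulr_gt0// => /le_trans -> //.
by rewrite le_eqVlt; apply/orP; left; apply/eqP; field.
Qed.

End fejer.
Arguments box_freq {N} n k.

(** * Summation over the frequency lattice *)

Section summability.
Variables (R : realType).

(** The right-hand side is an increment of the bounded increasing function
[5 p / (1 + |p|)], hence sums of the left-hand side telescope over all integers,
negative ones included. *)
Lemma invsq_le_telescope (p : R) : 0 <= p \/ p <= -1 ->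
  (1 + p ^+ 2)^-1 <= 5 * (p + 1) / (1 + `|p + 1|) - 5 * p / (1 + `|p|).
Proof.
have q0 : 0 < 1 + p ^+ 2 by rewrite ltr_pwDl// sqr_ge0.
case=> p0.
  rewrite !ger0_norm//; last by lra.
  have -> : 5 * (p + 1) / (1 + (p + 1)) - 5 * p / (1 + p) = 5 / ((p + 1) * (p + 2)).
    by field; apply/andP; split; apply/eqP; lra.
  have r0 : 0 < (p + 1) * (p + 2) by apply: mulr_gt0; lra.
  rewrite -[leLHS]mul1r ler_pdivrMr// mulrAC ler_pdivlMr//.
  by have := sqr_ge0 (p - 3 / 8); nra.
rewrite !ler0_norm//; [|lra..].
have -> : 5 * (p + 1) / (1 - (p + 1)) - 5 * p / (1 - p) = 5 / ((- p) * (1 - p)).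
  by field; apply/and3P; split; apply/eqP; lra.
have r0 : 0 < (- p) * (1 - p) by apply: mulr_gt0; lra.
rewrite -[leLHS]mul1r ler_pdivrMr// mulrAC ler_pdivlMr//.
by have := sqr_ge0 (p + 1 / 8); nra.
Qed.

Lemma sum_invsq_le (n : nat) (k : int) :
  \sum_(m < n) (1 + (k - (m : nat)%:Z)%:~R ^+ 2)^-1 <= 10 :> R.
Proof.
pose g (m : nat) : R := 5 * (m%:Z - k)%:~R / (1 + `|(m%:Z - k)%:~R|).
have gb m : `|g m| <= 5.
  rewrite /g normrM normrM normfV [`|5|]ger0_norm//.
  have d0 : 0 < 1 + `|(m%:Z - k)%:~R| :> R by rewrite ltr_pwDl.
  rewrite [`|1 + _|]ger0_norm ?(ltW d0)// -mulrA ler_piMr//.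
  by rewrite ler_pdivrMr// mul1r lerDr.
apply: (@le_trans _ _ (\sum_(0 <= m < n) (g m.+1 - g m))).
  rewrite big_mkord; apply: ler_sum => m _.
  have -> : (k - (m : nat)%:Z)%:~R ^+ 2 = ((m : nat)%:Z - k)%:~R ^+ 2 :> R.
    by rewrite -sqrrN -rmorphN opprB.
  have -> : g m.+1 = 5 * (((m : nat)%:Z - k)%:~R + 1) /
      (1 + `|((m : nat)%:Z - k)%:~R + 1|).
    rewrite /g -[1 in RHS]/(1%:~R) -intrD.
    by have -> : (m.+1%:Z - k) = (m : nat)%:Z - k + 1 by lia.
  apply: invsq_le_telescope.
  have [h|h] := leP 0 ((m : nat)%:Z - k); first by left; rewrite ler0z.
  right; rewrite -[-1]/((-1)%:~R) ler_int; lia.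
rewrite telescope_sumr//; have := gb n; have := gb 0; rewrite !ler_norml; lra.
Qed.

Variable N : nat.
Implicit Types (xi : 'rV[int]_N).

Definition freq_weight xi : R := \prod_i (1 + (xi 0 i)%:~R ^+ 2).

Lemma freq_weight_gt0 xi : 0 < freq_weight xi.
Proof. by apply: prodr_gt0 => i _; rewrite ltr_pwDl// sqr_ge0. Qed.

(** The weight is a product over the coordinates, so that the sum over the box
factors into one-dimensional sums. *)
Lemma sum_freq_weight_le n (k : {ffun 'I_N -> 'I_n.+1}) :
  \sum_l (freq_weight (box_freq n k - box_freq n l))^-1 <= 10 ^+ N.
Proof.
pose F i (m : 'I_n.+1) : R := (1 + ((k i : nat)%:Z - (m : nat)%:Z)%:~R ^+ 2)^-1.
rewrite (eq_bigr (fun l : {ffun 'I_N -> 'I_n.+1} => \prod_i F i (l i))); last first.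
  move=> l _; rewrite /freq_weight -prodfV; apply: eq_bigr => i _.
  by rewrite !mxE.
rewrite -bigA_distr_bigA /=.
apply: (@le_trans _ _ (\prod_(i < N) 10)); last by rewrite prodr_const card_ord.
apply: ler_prod => i _; rewrite sum_invsq_le andbT.
by apply: sumr_ge0 => m _; rewrite invr_ge0 addr_ge0// sqr_ge0.
Qed.

Lemma sum_lt_le (n j : nat) : (\sum_(m < n) (m < j) <= j)%N.
Proof.
suff : (\sum_(m < n) (m < j) <= minn n j)%N by lia.
elim: n => [|n IH]; first by rewrite big_ord0.
by rewrite big_ord_recr /=; move: IH; case: (ltnP n j) => /=; lia.
Qed.

Lemma sum_gt_le (n j : nat) : (\sum_(m < n.+1) (n < m + j) <= j)%N.
Proof.
suff H p : (\sum_(m < p) (n < m + j) <= p + j - n.+1)%N by have := H n.+1; lia.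
elim: p => [|p IH]; first by rewrite big_ord0.
by rewrite big_ord_recr /=; move: IH; case: (ltnP n (p + j)) => /=; lia.
Qed.

Definition near_boundary n (j : nat) (m : 'I_n.+1) : bool :=
  (m < j)%N || (n < m + j)%N.

Arguments near_boundary : clear implicits.

Lemma card_near_boundary n j : (#|near_boundary n j| <= j.*2)%N.
Proof.
rewrite -sum1_card big_mkcond /= -addnn.
apply: leq_trans (leq_add (sum_lt_le n.+1 j) (sum_gt_le n j)).
rewrite -big_split /=; apply: leq_sum => m _; rewrite unfold_in /near_boundary.
by case: (m < j)%N; case: (n < m + j)%N.
Qed.

Definition freq_ball (j : nat) : set 'rV[int]_N :=
  [set xi | freq_norm R xi <= j%:R].

Lemma freq_ballP j xi :
  freq_norm R xi <= j%:R <-> \sum_i (xi 0 i)%:~R ^+ 2 <= j%:R ^+ 2 :> R.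
Proof.
have S0 : 0 <= \sum_i (xi 0 i)%:~R ^+ 2 :> R by apply: sumr_ge0 => i _; exact: sqr_ge0.
rewrite /freq_norm -[X in _ <= X <-> _]ger0_norm ?ler0n// -sqrtr_sqr.
by rewrite ler_sqrt// sqr_ge0.
Qed.

Lemma freq_ball_coord j xi : freq_ball j xi -> forall i, `|xi 0 i| <= j%:Z.
Proof.
move=> /freq_ballP xij i; rewrite -(ler_int R).
rewrite intr_norm -[leRHS]ger0_norm ?ler0n// -ler_sqr ?nnegrE// !real_normK ?num_real//.
apply: le_trans xij; rewrite (bigD1 i)//= lerDl sumr_ge0// => *; exact: sqr_ge0.
Qed.

Lemma freq_ball_box n j (k : {ffun 'I_N -> 'I_n.+1}) xi :
  (forall i, ~~ near_boundary n j (k i)) -> freq_ball j xi ->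
  exists l, xi = box_freq n k - box_freq n l.
Proof.
move=> kj xij; have xi_le := freq_ball_coord xij.
exists [ffun i => inord (absz ((k i : nat)%:Z - xi 0 i)%R)].
apply/rowP => i; rewrite !mxE ffunE.
have := kj i; rewrite /near_boundary negb_or -!leqNgt => /andP[k1 k2].
have xii := xi_le i; rewrite inordK; lia.
Qed.

Lemma finite_freq_ball j : finite_set (freq_ball j).
Proof.
pose k : {ffun 'I_N -> 'I_(2 * j).+1} := [ffun=> inord j].
apply: (@sub_finite_set _ _ [set box_freq (2*j) k - box_freq (2 * j) l | l in setT]).
  move=> xi /(@freq_ball_box _ j k)[i|l ->]; last by exists l.
  by rewrite ffunE /near_boundary inordK; lia.
exact/finite_image/finite_finset.
Qed.

(** When [k] is at distance at least [j] from the boundary of the box, the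
differences [k - l] cover the ball of radius [j], each point once. *)
Lemma sum_freq_ball (A : nmodType) n j (k : {ffun 'I_N -> 'I_n.+1})
    (c : 'rV[int]_N -> A) :
  (forall i, ~~ near_boundary n j (k i)) ->
  \sum_(xi \in freq_ball j) c xi =
  \sum_(l | freq_norm R (box_freq n k - box_freq n l) <= j%:R)
     c (box_freq n k - box_freq n l).
Proof.
move=> kj; rewrite fsbig_finite/=; last exact: finite_freq_ball.
rewrite -[RHS]big_filter -(big_map (fun l => box_freq n k - box_freq n l) xpredT c).
apply: perm_big; apply: uniq_perm => [||xi].
- exact: finmap.fset_uniq.
- rewrite map_inj_uniq ?filter_uniq ?index_enum_uniq// => l l' /addrI/oppr_inj.
  exact: box_freq_inj.
rewrite in_fset_set; last exact: finite_freq_ball.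
apply/idP/mapP.
  rewrite inE => xij; have [l lE] := freq_ball_box kj xij.
  by exists l => //; rewrite mem_filter mem_index_enum -lE andbT.
by case=> l; rewrite mem_filter => /andP[lj _] ->; rewrite inE.
Qed.


Lemma normc_sum (I : Type) (r : seq I) (P : pred I) (F : I -> R[i]) :
  Normc.normc (\sum_(i <- r | P i) F i) <= \sum_(i <- r | P i) Normc.normc (F i).
Proof.
elim/big_rec2 : _ => [|i y z _ h]; first by rewrite Normc.normc0.
by rewrite (le_trans (normcD _ _))// lerD2l.
Qed.

Section box_average.
Variables (c : 'rV[int]_N -> R[i]) (A : R).
(* [1 + |xi|^2] comes in addition to the summable [freq_weight]: it is the source
   of the decay in [j] *)
Hypothesis cA : forall xi,
  Normc.normc (c xi) * freq_weight xi * (1 + \sum_i (xi 0 i)%:~R ^+ 2) <= A.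

Let sumsq_ge0 xi : 0 <= \sum_i (xi 0 i)%:~R ^+ 2 :> R.
Proof. by apply: sumr_ge0 => i _; exact: sqr_ge0. Qed.

Let A_ge0 : 0 <= A.
Proof.
apply: le_trans (cA 0); rewrite mulr_ge0 ?addr_ge0//.
by rewrite mulr_ge0 ?normc_ge0// ltW// freq_weight_gt0.
Qed.

Let c_le xi (D : R) : 0 < D -> D <= 1 + \sum_i (xi 0 i)%:~R ^+ 2 ->
  Normc.normc (c xi) <= A / D * (freq_weight xi)^-1.
Proof.
move=> D0 Dxi; rewrite ler_pdivlMr ?freq_weight_gt0// ler_pdivlMr//.
apply: le_trans (cA xi); rewrite ler_wpM2l// mulr_ge0 ?normc_ge0// ltW//.
exact: freq_weight_gt0.
Qed.

Let row_sum_le n (k : {ffun 'I_N -> 'I_n.+1}) (P : pred {ffun 'I_N -> 'I_n.+1}) (D : R) :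
  0 < D ->
  (forall l, P l ->
     D <= 1 + \sum_i ((box_freq n k - box_freq n l) 0 i)%:~R ^+ 2) ->
  Normc.normc (\sum_(l | P l) c (box_freq n k - box_freq n l)) <= A / D * 10 ^+ N.
Proof.
move=> D0 PD; apply: le_trans (normc_sum _ _ _) _.
apply: (@le_trans _ _ (\sum_(l | P l)
    A / D * (freq_weight (box_freq n k - box_freq n l))^-1)).
  by apply: ler_sum => l Pl; apply: c_le => //; exact: PD.
rewrite -mulr_sumr ler_wpM2l ?divr_ge0// ?(ltW D0)//.
apply: le_trans (sum_freq_weight_le k).
rewrite [leRHS](bigID P)/= lerDl sumr_ge0// => l _.
by rewrite invr_ge0 ltW// freq_weight_gt0.
Qed.

(** An inner sum over [l] differs from [S] by at most the tail of the series off the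
ball when [k] is away from the boundary; for the other [k], a proportion [O(1/n)] of
the box, the inner sum and [S] are bounded separately. *)
Lemma box_average_ball n j (S := \sum_(xi \in freq_ball j) c xi) :
  Normc.normc (((n.+1%:R ^+ N)^-1 : R)%:C%C *
    \sum_k \sum_l c (box_freq n k - box_freq n l) - S) <=
  A * 10 ^+ N / (1 + j%:R ^+ 2) +
  (A * 10 ^+ N + Normc.normc S) * (N%:R * j.*2%:R) / n.+1%:R.
Proof.
set w : R := n.+1%:R ^+ N; have w0 : 0 < w by rewrite exprn_gt0.
set T := A * 10 ^+ N + _; have T0 : 0 <= T.
  by rewrite addr_ge0 ?normc_ge0// mulr_ge0// exprn_ge0.
have j0 : 0 < 1 + j%:R ^+ 2 :> R by rewrite ltr_pwDl// sqr_ge0.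
have -> : (w^-1)%:C%C * (\sum_k \sum_l c (box_freq n k - box_freq n l)) - S =
  (w^-1)%:C%C * \sum_k (\sum_l c (box_freq n k - box_freq n l) - S).
  rewrite sumrB sumr_const card_ffun !card_ord mulrBr; congr (_ - _).
  rewrite -[_ *+ _]mulr_natl mulrA natrX -(rmorph_nat (real_complex R)).
  by rewrite -rmorphXn -rmorphM mulVf ?gt_eqF// mul1r.
rewrite Normc.normcM normc_real ger0_norm ?invr_ge0 ?(ltW w0)// mulrC ler_pdivrMr//.
apply: le_trans (normc_sum _ _ _) _.
apply: (@le_trans _ _ (\sum_(k : {ffun 'I_N -> 'I_n.+1}) (A * 10 ^+ N / (1 + j%:R ^+ 2) +
    T * \sum_i (near_boundary n j (k i))%:R))).
  apply: ler_sum => k _.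
  have [bad|good] := pselect (exists i, near_boundary n j (k i)).
    apply: (@le_trans _ _ T).
      rewrite (le_trans (normcD _ _))// normcN lerD2r.
      have := @row_sum_le n k xpredT 1 ltr01; rewrite divr1; apply => l _.
      by rewrite lerDl.
    rewrite (@le_trans _ _ (T * \sum_i (near_boundary n j (k i))%:R))//.
      rewrite ler_peMr// -natr_sum ler1n; have [i ki] := bad.
      by rewrite (bigD1 i)//= ki.
    by rewrite lerDr divr_ge0 ?mulr_ge0 ?exprn_ge0// ltW.
  have kj i : ~~ near_boundary n j (k i) by apply/negP => h; apply: good; exists i.
  have -> : \sum_i (near_boundary n j (k i))%:R = 0 :> R.
    by rewrite big1// => i _; rewrite (negbTE (kj i)).
  rewrite mulr0 addr0.
  rewrite /S (@sum_freq_ball _ n j k c kj).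
  rewrite (bigID (fun l => freq_norm R (box_freq n k - box_freq n l) <= j%:R))/=.
  rewrite addrAC subrr add0r mulrAC; apply: row_sum_le => // l.
  by move=> /negP/freq_ballP/negP; rewrite -ltNge => /ltW; rewrite lerD2l.
rewrite big_split /= sumr_const card_ffun !card_ord -[_ *+ _]mulr_natr natrX -/w.
rewrite mulrDl lerD2l -mulr_sumr -!mulrA ler_wpM2l// exchange_big /=.
have -> : N%:R * (j.*2%:R * (n.+1%:R^-1 * w)) = \sum_(i < N) (j.*2%:R * (n.+1%:R^-1 * w)).
  by rewrite sumr_const card_ord mulr_natl.
apply: ler_sum => i _.
rewrite mulrCA -(mulKf (_ : n.+1%:R != 0 :> R) (\sum_k _)) ?pnatr_eq0//.
have := @sum_box_coord R N n i (near_boundary n j) => ->.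
rewrite ler_wpM2l ?invr_ge0// ler_wpM2r ?(ltW w0)// ler_nat.
exact: card_near_boundary.
Qed.

End box_average.

End summability.

(** * The error of the Fourier partial sums *)

Section fourier_error.
Variables (R : realType) (N : nat).
Local Notation V := 'rV[R]_N.
Implicit Types (f : V -> R[i]) (xi : 'rV[int]_N).

(** The Fejer means tend to [f x], while they stay within the tail plus [O(1/n)]
of the partial sum; let [n] go to infinity. *)
Lemma fourier_partial_sum_error f (A : R) (x : V) j :
  torus_periodic f -> bounded_lipschitz f ->
  (forall xi, Normc.normc (fourier_term f x xi) * freq_weight R xi *
     (1 + \sum_i (xi 0 i)%:~R ^+ 2) <= A) ->
  Normc.normc (\sum_(xi \in freq_ball R j) fourier_term f x xi - f x) <=
  A * 10 ^+ N / (1 + j%:R ^+ 2).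
Proof.
move=> pf lf fA; apply/ler_addgt0Pr => e e0.
have e20 : 0 < e / 2 by rewrite divr_gt0.
have [C C0 fC] := fejer_mean pf lf x e20.
set S := \sum_(xi \in _) _.
pose T := (A * 10 ^+ N + Normc.normc S) * (N%:R * j.*2%:R).
have boxT n := @box_average_ball R N _ A fA n j; rewrite /= -/S -/T in boxT.
pose n := Num.bound (2 * (`|C| + `|T|) / e).
have nP : (C + T) / n.+1%:R <= e / 2.
  have h : 2 * (`|C| + `|T|) / e <= n.+1%:R.
    apply: ltW; apply: lt_le_trans (archi_boundP _) _.
      by rewrite divr_ge0 ?mulr_ge0 ?addr_ge0// ltW.
    by rewrite ler_nat.
  rewrite ler_pdivrMr//; apply: le_trans (lerD (ler_norm C) (ler_norm T)) _.
  move: h; rewrite ler_pdivrMr//; lra.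
set avg := (n.+1%:R ^- N)%:C%C *
  \sum_k \sum_l fourier_term f x (box_freq n k - box_freq n l).
have -> : S - f x = - (avg - S) + (avg - f x) by ring.
apply: le_trans (normcD _ _) _; rewrite normcN.
apply: le_trans (lerD (boxT n) (fC n)) _.
by rewrite -addrA lerD2l addrCA [leRHS]splitr lerD2l addrC -mulrDl.
Qed.

Lemma prod_mi_seq (g : 'I_N -> R) (a : {ffun 'I_N -> nat}) :
  \prod_(j <- mi_seq a) g j = \prod_j g j ^+ a j.
Proof.
rewrite /mi_seq big_flatten big_map /= big_enum /=.
by apply: eq_bigr => j _; rewrite big_nseq iter_mulr_1.
Qed.

(** With [i] the largest coordinate of [xi] in absolute value and [q] its square,
the left-hand side is at most [N * (1 + q) ^+ N.+1], and
[(1 + q) ^+ r <= 2 ^+ r * (1 + q ^+ r)].  One pure power of one coordinate thus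
suffices, that is, one further derivative of order [2N + 2]. *)
Lemma freq_weight_le xi : (0 < N)%N -> exists i,
  freq_weight R xi * (1 + \sum_i (xi 0 i)%:~R ^+ 2) <=
  N%:R * 2 ^+ N.+1 * (1 + `|(xi 0 i)%:~R| ^+ N.+1.*2).
Proof.
move=> N0; pose i0 : 'I_N := Ordinal N0.
pose i := [arg max_(i > i0) absz (xi 0 i)%R]; exists i.
have iP k : `|(xi 0 k)%:~R| <= `|(xi 0 i)%:~R| :> R.
  rewrite /i; case: arg_maxnP => // m _ /(_ k isT) h.
  have E l : `|(xi 0 l)%:~R| = `|xi 0 l|%:~R :> R by rewrite intr_norm.
  by rewrite !E ler_int; move: h; rewrite /=; lia.
set m : R := `|(xi 0 i)%:~R| in iP *.
have m2 k : (xi 0 k)%:~R ^+ 2 <= m ^+ 2 :> R.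
  by rewrite -[leLHS]real_normK ?num_real// ler_sqr ?nnegrE /m ?normr_ge0.
have q0 : 0 <= m ^+ 2 by exact: sqr_ge0.
apply: (@le_trans _ _ ((1 + m ^+ 2) ^+ N * (N%:R * (1 + m ^+ 2)))).
  apply: ler_pM.
  - exact/ltW/freq_weight_gt0.
  - by rewrite addr_ge0// sumr_ge0// => k _; exact: sqr_ge0.
  - rewrite /freq_weight -[in leRHS](card_ord N) -prodr_const; apply: ler_prod => k _.
    by rewrite addr_ge0 ?sqr_ge0// lerD2l m2.
  - rewrite mulrDr mulr1 lerD//; first by rewrite ler1n.
    rewrite mulr_natl -[in leRHS](card_ord N) -sumr_const; apply: ler_sum => k _.
    exact: m2.
rewrite mulrCA -exprSr -mulrA ler_wpM2l//.
rewrite -[in leRHS]muln2 mulnC exprM.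
move: (m ^+ 2) q0 => q q0.
have [q1|q1] := leP q 1.
  apply: (@le_trans _ _ (2 ^+ N.+1)).
    by rewrite lerXn2r ?nnegrE//; lra.
  by rewrite ler_peMr ?exprn_ge0// lerDl exprn_ge0.
apply: (@le_trans _ _ ((2 * q) ^+ N.+1)).
  by rewrite lerXn2r ?nnegrE//; lra.
by rewrite exprMn ler_wpM2l ?exprn_ge0// lerDr.
Qed.

Lemma normc_fourier_term f x xi :
  Normc.normc (fourier_term f x xi) =
  ((2 * pi) ^+ N)^-1 * Normc.normc (torus_integral (fun t => f t * torus_exp xi t)).
Proof.
rewrite /fourier_term !Normc.normcM normc_torus_exp mulr1 normc_real ger0_norm//.
by rewrite invr_ge0 exprn_ge0// mulr_ge0// pi_ge0.
Qed.

(** Both Fourier terms are that of [f] times the monomials of the two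
multi-indices, up to a sign. *)
Lemma fourier_term_mderive_scale f (a b : {ffun 'I_N -> nat}) x xi (c : R) :
  torus_smooth f ->
  \prod_j `|(xi 0 j)%:~R| ^+ b j = c * \prod_j `|(xi 0 j)%:~R| ^+ a j ->
  Normc.normc (fourier_term (mderive b f) x xi) =
  c * Normc.normc (fourier_term (mderive a f) x xi).
Proof.
move=> sf abc; rewrite !normc_fourier_term mulrCA; congr (_ * _).
rewrite !torus_integral_iterD_exp// !Normc.normcM mulrA; congr (_ * _).
have E (d : {ffun 'I_N -> nat}) :
    Normc.normc (\prod_(j <- mi_seq d) - (xi 0 j)%:~R : R[i]) =
    \prod_j `|(xi 0 j)%:~R : R| ^+ d j.
  rewrite -prod_mi_seq; elim: (mi_seq d) => [|j s IH].
    by rewrite !big_nil Normc.normc1.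
  rewrite !big_cons Normc.normcM IH normcN; congr (_ * _).
  by rewrite -normc_real rmorph_int.
by rewrite !E.
Qed.

Lemma normc_fourier_term_le f (B : R) x xi : bounded_lipschitz f ->
  (forall t, Normc.normc (f t) <= B) ->
  Normc.normc (fourier_term f x xi) <= 2 * B.
Proof.
move=> lf fB; rewrite normc_fourier_term mulrC ler_pdivrMr; last first.
  by rewrite exprn_gt0// mulr_gt0// pi_gt0.
rewrite mulrAC; apply: normc_torus_integral => [|t].
  by apply: bounded_lipschitzM => //; exact: bounded_lipschitz_exp.
by rewrite Normc.normcM normc_torus_exp mulr1.
Qed.

End fourier_error.

(** * Fourier partial sums of ultradifferentiable functions *)

Section ultra_error.
Variables (R : realType) (N : nat) (M : weight_seq R).
Local Notation V := 'rV[R]_N.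
Local Notation mindex := {ffun 'I_N -> nat}.

Lemma bin_le_exp2 n p : ('C(n, p) <= 2 ^ n)%N.
Proof.
elim: n p => [|n IH] [|p]; rewrite ?bin0 ?bin0n ?expn_gt0//.
by rewrite binS expnS mul2n -addnn leq_add.
Qed.

Lemma fact_add_le n p : ((n + p)`! <= 2 ^ (n + p) * (n`! * p`!))%N.
Proof.
have := @bin_fact (n + p) n (leq_addr _ _); rewrite addKn => <-.
by rewrite leq_mul2r bin_le_exp2 orbT.
Qed.

(** The growth condition separates the weight sequence and
[(n + p)! <= 2^(n + p) n! p!] the factorials; both exponential factors go into
[K]. *)
Lemma ultra_weight_add : exists2 K : R, 1 <= K & forall h n p, 0 < h ->
  ultra_weight M h (n + p) <=
  ultra_weight M (K * h) n * ultra_weight M (K * h) p.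
Proof.
have [H H1 MH] := wseq_growth M; exists (2 * H) => [|h n p h0]; first by lra.
have H0 : 0 < H by lra.
rewrite /ultra_weight.
apply: (@le_trans _ _ (h ^+ (n + p) * (H ^+ (n + p) * M n * M p) *
    (2 ^+ (n + p) * (n`!%:R * p`!%:R)))).
  apply: ler_pM.
  - by rewrite mulr_ge0 ?exprn_ge0// ltW// wseq_gt0.
  - by [].
  - by rewrite ler_wpM2l ?exprn_ge0// ltW.
  - by rewrite -natrX -!natrM ler_nat fact_add_le.
rewrite !exprMn !exprD; rewrite le_eqVlt; apply/orP; left; apply/eqP; ring.
Qed.

(** By [freq_weight_le] the hypothesis of [fourier_partial_sum_error] for
[mderive a phi] needs bounds for derivatives of orders [|a|] and [|a| + 2N + 2]
only, and [ultra_weight_add] bounds the weights of both by a constant times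
that of [|a|] with [K * h] in place of [h]. *)
Lemma ultradiff_fourier_error (phi : V -> R[i]) : (0 < N)%N -> ultradiff M phi ->
  exists A h, [/\ 0 <= A, 0 < h & forall j x (a : mindex),
    Normc.normc (\sum_(xi \in freq_ball R j) fourier_term (mderive a phi) x xi
       - mderive a phi x) <= A / (1 + j%:R ^+ 2) * ultra_weight M h (mi_deg a)].
Proof.
move=> N0 [pphi sphi [C [h [C0 h0 phiC]]]].
have [K K1 KW] := ultra_weight_add.
have Kh0 : 0 < K * h by rewrite mulr_gt0//; lra.
have hKh : h <= K * h by rewrite ler_peMl// ltW.
have W0 n := ultra_weight_gt0 M n Kh0.
pose q := N.+1.*2.
pose B : R := N%:R * 2 ^+ N.+1 * (2 * C) * (1 + ultra_weight M (K * h) q).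
have B0 : 0 <= B.
  by rewrite !mulr_ge0 ?exprn_ge0 ?addr_ge0 ?(ltW C0) ?(ltW (W0 q)).
exists (B * 10 ^+ N), (K * h); split=> [||j x a] //; first by rewrite mulr_ge0 ?exprn_ge0.
have smd b : torus_smooth (mderive b phi) by exact: torus_smooth_iterD.
have lmd b := torus_smooth_bounded_lipschitz (smd b).
have termC b xi : Normc.normc (fourier_term (mderive b phi) x xi) <=
    2 * C * ultra_weight M h (mi_deg b).
  by rewrite -mulrA; apply: normc_fourier_term_le => // t; exact: phiC.
apply: le_trans (@fourier_partial_sum_error _ _ _
  (B * ultra_weight M (K * h) (mi_deg a)) x j (smd a).1 (lmd a) _) _; last first.
  by rewrite le_eqVlt; apply/orP; left; apply/eqP; ring.
move=> xi; have [i xi_i] := @freq_weight_le R N xi N0.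
rewrite -mulrA; apply: le_trans (ler_wpM2l (normc_ge0 _) xi_i) _.
(* [q] more derivatives in the direction of the largest coordinate of [xi] *)
pose b : mindex := [ffun k => (a k + (k == i) * q)%N].
have bE : Normc.normc (fourier_term (mderive b phi) x xi) =
    `|(xi 0 i)%:~R| ^+ q * Normc.normc (fourier_term (mderive a phi) x xi).
  apply: fourier_term_mderive_scale => //.
  under eq_bigr do rewrite ffunE exprD.
  rewrite big_split /= mulrC; congr (_ * _); rewrite (bigD1 i)//= eqxx mul1n.
  by rewrite big1 ?mulr1// => k /negbTE ->; rewrite expr0.
have degb : mi_deg b = (mi_deg a + q)%N.
  rewrite /mi_deg; under eq_bigr do rewrite ffunE.
  rewrite big_split /=; congr (_ + _)%N; rewrite (bigD1 i)//= eqxx mul1n.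
  by rewrite big1 ?addn0// => k /negbTE ->.
rewrite mulrCA -mulrA -/q mulrDr mulr1 [X in _ + X]mulrC -bE.
rewrite /B -!mulrA; do 2 (rewrite ler_wpM2l ?exprn_ge0//).
have -> w v : 2 * (C * ((1 + w) * v)) = 2 * C * v + 2 * C * (w * v) :> R by ring.
apply: lerD.
  apply: le_trans (termC a xi) _; rewrite ler_wpM2l ?mulr_ge0// ?(ltW C0)//.
  exact: ultra_weight_le.
apply: le_trans (termC b xi) _; rewrite ler_wpM2l ?mulr_ge0// ?(ltW C0)//.
by rewrite degb [leRHS]mulrC; exact: KW.
Qed.

Definition ultra_partial_sum (phi : ultra N M) (j : nat) : ultra N M :=
  \sum_(xi <- finmap.enum_fset (fset_set (@freq_ball R N j)))
    ((((2 * pi) ^+ N)^-1 : R)%:C%C * torus_integral (fun t => phi t * torus_exp xi t))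
      *: ultra_exp M (- xi).

Lemma ultra_funD (f g : ultra N M) : f + g = (f : V -> R[i]) + g :> (V -> R[i]).
Proof. by []. Qed.

Lemma mderive_partial_sum (phi : ultra N M) j (a : mindex) x :
  mderive a (ultra_partial_sum phi j) x =
  \sum_(xi \in freq_ball R j) fourier_term (mderive a phi) x xi.
Proof.
rewrite fsbig_finite /=; last exact: finite_freq_ball.
have [pphi sphi _] := ultraP phi.
rewrite /ultra_partial_sum; elim: (finmap.enum_fset _) => [|xi s IH].
  by rewrite !big_nil ultra_fun0 mderive0.
rewrite !big_cons ultra_funD ultra_funZ.
set T := \sum_(xi0 <- s) _ in IH *; have [_ sT _] := ultraP T.
rewrite mderive_lin; [|exact: smooth_exp|exact: sT].
rewrite -[LHS]/(_ * mderive a (torus_exp (- xi)) x + mderive a _ x) IH; congr (_ + _).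
rewrite /fourier_term torus_integral_iterD_exp// /mderive iterD_exp.
have -> : (\prod_(k <- mi_seq a) ((- xi) 0 k)%:~R : R)%:C%C =
    \prod_(k <- mi_seq a) - (xi 0 k)%:~R.
  rewrite rmorph_prod; apply: eq_bigr => k _.
  by rewrite mxE intrN rmorphN rmorph_int.
by rewrite -[X in _ * X = _]/(_ * torus_exp (- xi) x); ring.
Qed.

End ultra_error.

(** * Convergence in the dual space *)

Section duality.
Variables (R : realType) (N : nat) (M : weight_seq R) (h : nat -> R).
Local Notation V := 'rV[R]_N.

Lemma fun_distribution_fourier_sum (u : {scalar indlim N M h}) j (phi : ultra N M) :
  fun_distribution (fourier_sum u j) phi = u (ultra_partial_sum phi j).
Proof.
have lphi : bounded_lipschitz phi.
  by have [pphi sphi _] := ultraP phi; apply: torus_smooth_bounded_lipschitz.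
rewrite /fun_distribution /fourier_sum.
have -> : (fun x => (\sum_(xi \in [set xi : 'rV[int]_N | freq_norm R xi <= j%:R])
     fourier_coef u xi * torus_exp xi x) * phi x) =
  (fun x => \sum_(xi <- finmap.enum_fset (fset_set (@freq_ball R N j)))
     fourier_coef u xi * (phi x * torus_exp xi x)).
  apply/funext => x; rewrite fsbig_finite/=; last exact: finite_freq_ball.
  by rewrite mulr_suml; apply: eq_bigr => xi _; ring.
rewrite torus_integral_sum => [|xi]; last first.
  by apply: bounded_lipschitzM => //; exact: bounded_lipschitz_exp.
rewrite /ultra_partial_sum (linear_sum u); apply: eq_bigr => xi _.
by rewrite (linearZ_LR u) /fourier_coef /= mulrAC.
Qed.

Lemma ultra_norm_le (g : ultra N M) (k B : R) : 0 < k -> 0 <= B ->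
  (forall x a, Normc.normc (mderive a g x) <= B * ultra_weight M k (mi_deg a)) ->
  forall k', k <= k' -> (ultra_norm k' g <= B%:E)%E.
Proof.
move=> k0 B0 gB k' kk'; apply: ge_ereal_sup => _ [[x a] _ <-] /=.
have k'0 := lt_le_trans k0 kk'.
rewrite lee_fin ler_pdivrMr ?ultra_weight_gt0//; apply: le_trans (gB x a) _.
by rewrite ler_wpM2l//; exact: ultra_weight_le.
Qed.

End duality.

Theorem theorem4p12 (R : realType) (N : nat) (M : weight_seq R) (h : nat -> R)
    (N_ge1 : (1 <= N)%N)
    (h_gt0 : forall n, 0 < h n)
    (h_incr : forall m n, (m < n)%N -> h m < h n)
    (h_infty : h @ \oo --> +oo)
    (u : ultradistribution N M h) :
  dual_cvg (fun j => fun_distribution (fourier_sum u j)) u.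
Proof.
move=> phi; under eq_fun do rewrite fun_distribution_fourier_sum.
(* the partial sums converge in the norm with parameter [k], hence in the coarser
   norm of the step [h n] *)
have [A [k [A0 k0 phiE]]] := ultradiff_fourier_error N_ge1 (ultraP phi).
have [n kn] : exists n, k <= h n.
  move/cvgryPge: h_infty => /(_ k) [n _ hn]; exists n; exact: hn n (leqnn n).
have cu : {for phi, continuous (u : indlim N M h -> R[i]^o)}.
  by case: u => u' cu; exact: cu.
move=> B /cu [U [_ sU UB]].
have [e e0 eU] := sU n.
rewrite -[nbhs _ B]/(\forall j \near \oo, B (u (ultra_partial_sum phi j))).
near=> j.
have -> : ultra_partial_sum phi j = phi + (ultra_partial_sum phi j - phi) :> indlim N M h.
  by rewrite addrC subrK.
apply: UB; apply: eU.
apply: (@le_lt_trans _ _ (A / (1 + j%:R ^+ 2))%:E).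
  apply: (@ultra_norm_le _ _ _ _ k) => //.
    by rewrite divr_ge0// addr_ge0// sqr_ge0.
  move=> x a.
  have -> : mderive a (ultra_partial_sum phi j - phi : ultra N M) x =
      \sum_(xi \in freq_ball R j) fourier_term (mderive a phi) x xi - mderive a phi x.
    rewrite -mderive_partial_sum.
    have [_ s1 _] := ultraP (ultra_partial_sum phi j).
    have [_ s2 _] := ultraP phi.
    rewrite addrC -scaleN1r ultra_funD ultra_funZ mderive_lin//.
    by rewrite -[LHS]/(-1 * _ + _) mulN1r addrC.
  exact: phiE.
rewrite lte_fin ltr_pdivrMr; last by rewrite ltr_pwDl// sqr_ge0.
have : A / e < j%:R by near: j; exact: nbhs_infty_gtr.
rewrite ltr_pdivrMr// => /lt_le_trans; apply; rewrite mulrC ler_wpM2l ?(ltW e0)//.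
by have := sqr_ge0 (j%:R - 1 : R); have := ler0n R j; nra.
Unshelve. all: by end_near. Qed.
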